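(* Let $k\geq1$. The class of ${\mathrm{PCF}}^\Omega_k$-denotable procedures-in-environment $\Gamma\vdash p$ is the class generated inductively by the following rules: 1. If $\Gamma\vdash q_i$ is denotable for each $i<r$ and $x\in\Gamma$, then $\Gamma\vdash\lambda.\mathtt{case}\ x\,q_0\cdots q_{r-1}\ \mathtt{of}\ (j\Rightarrow j)$ is denotable. 2. If $\Gamma,x\vdash p$ is denotable, then $\Gamma\vdash\lambda x.p$ is denotable. 3. Each $\Gamma\vdash\lambda.n$ is denotable. 4. If $\Gamma\vdash p$ is denotable and $f:\mathbb{N}\rightharpoonup\mathbb{N}$, then $\Gamma\vdash p[i\mapsto f(i)]$ is denotable. 5. If $\Gamma\vdash p$, $\Gamma\vdash\lambda.d$ and $\Gamma\vdash\lambda.e$ are denotable, then $\Gamma\vdash p[0\mapsto d,\ i+1\mapsto e]$ is denotable. 6. If $\Gamma\vdash\lambda z^\sigma x_0^{\sigma_0}\cdots x_{r-1}^{\sigma_{r-1}}.e$ is denotable where $\sigma=\sigma_0,\ldots,\sigma_{r-1}\rightarrow\mathbb{N}$ is of level $\le k$, and $\Gamma\vdash q_i:\sigma_i$ is denotable for each $i<r$, then $\Gamma\vdash\lambda.\langle\!\langle\Pi_{\Gamma,Z}(e,\xi)\rangle\!\rangle$ is denotable, where $Z=z,\vec x$ is disjoint from $\Gamma$, $\xi(z)=\lambda\vec x.e$ and $\xi(x_i)=q_i$ for each $i$.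
   Context: Levels: ${\mathrm{lv}}(\mathbb{N})=0$, ${\mathrm{lv}}(\sigma\rightarrow\tau)=\max({\mathrm{lv}}\,\sigma+1,{\mathrm{lv}}\,\tau)$. ${\mathrm{PCF}}^\Omega$: simply typed $\lambda$-calculus over $\mathbb{N}$ with constants $\underline n$, $\mathit{suc},\mathit{pre}$, $\mathit{ifzero}$, $Y_\sigma:(\sigma\rightarrow\sigma)\rightarrow\sigma$ for all $\sigma$, and $C_f:\mathbb{N}\rightarrow\mathbb{N}$ for each partial $f:\mathbb{N}\rightharpoonup\mathbb{N}$; ${\mathrm{PCF}}^\Omega_k$ admits $Y_\sigma$ only for ${\mathrm{lv}}(\sigma)\le k$. NSPs: coinductively generated well-typed trees $p::=\lambda\vec x.e$, $e::=\bot\mid n\mid\mathtt{case}\ a\ \mathtt{of}\ (i\Rightarrow e_i\mid i\in\mathbb{N})$, $a::=x\,q_0\cdots q_{r-1}$, modulo $\alpha$; meta-terms add $P\vec Q$ and $\mathtt{case}\ G\ \mathtt{of}(\ldots)$ for arbitrary ground $G$, and $\langle\!\langle T\rangle\!\rangle$ is the limit of reduction by $\beta$, $\mathtt{case}\ \bot\rightsquigarrow\bot$, $\mathtt{case}\ n\ \mathtt{of}(i\Rightarrow E_i)\rightsquigarrow E_n$ and case-of-case commutation. Application $(\lambda x_0\cdots x_r.e)\cdot q=\lambda x_1\cdots x_r.\langle\!\langle e[x_0\mapsto q]\rangle\!\rangle$, $x^\eta=\lambda\vec z.\mathtt{case}\ x\vec z^{\,\eta}\ \mathtt{of}(i\Rightarrow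 i)$. The interpretation: $[\![x]\!]=x^\eta$, $[\![\underline n]\!]=\lambda.n$, $[\![\mathit{suc}]\!]=\lambda x.\mathtt{case}\ x\ \mathtt{of}(i\Rightarrow i+1)$, $[\![\mathit{pre}]\!]=\lambda x.\mathtt{case}\ x\ \mathtt{of}(0\Rightarrow0\mid i+1\Rightarrow i)$, $[\![\mathit{ifzero}]\!]=\lambda xyz.\mathtt{case}\ x\ \mathtt{of}(0\Rightarrow\mathtt{case}\ y\ \mathtt{of}(j\Rightarrow j)\mid i+1\Rightarrow\mathtt{case}\ z\ \mathtt{of}(j\Rightarrow j))$, $[\![C_f]\!]=\lambda x.\mathtt{case}\ x\ \mathtt{of}(i\Rightarrow f(i))$, $[\![Y_\sigma]\!]=\lambda g.F_\sigma[g]$, $F_\sigma[g]=\lambda\vec x.\mathtt{case}\ g(F_\sigma[g])\vec x^{\,\eta}\ \mathtt{of}(i\Rightarrow i)$, $[\![\lambda x.M]\!]_\Gamma=\lambda x.[\![M]\!]_{\Gamma,x}$, $[\![MN]\!]_\Gamma=[\![M]\!]_\Gamma\cdot[\![N]\!]_\Gamma$. $\Gamma\vdash p$ is ${\mathrm{PCF}}^\Omega_k$-denotable if $p=[\![M]\!]_\Gamma$ for some ${\mathrm{PCF}}^\Omega_k$ term $\Gamma\vdash M$. Rightward numeral leaves of $t$: $n$ in itself; those of $e$ in $\lambda\vec x.e$; those of each $e_i$ in $\mathtt{case}\ a\ \mathtt{of}(i\Rightarrow e_i)$; $t[i\mapsto e_i]$ replaces each rightward leaf $i$ by $e_i$ ($f(i)$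 read as $\bot$ if undefined). Plugging: for $\Gamma$, a list $Z$ of variables of level $\le k$ disjoint from $\Gamma$, $\Gamma,Z\vdash e$, and $\xi$ with $\Gamma,Z\vdash\xi(z):\sigma$ for $z^\sigma\in Z$, let $T^\circ$ replace each ground subterm $z\vec Q$ ($z\in Z$) of $T$ by $\bot$; $\Pi^0=e$, $\Pi^{m+1}=\Pi^m[z\mapsto\xi(z)\ \forall z\in Z]$, $\Pi_{\Gamma,Z}(e,\xi)=\bigsqcup_m(\Pi^m)^\circ$. *)

(* Defs.v *)
(* Nested sequential procedures (NSPs), meta-terms, PCF^Omega,
   and the NSP interpretation, following the paper's definitions.
   Variables are represented by de Bruijn LEVELS: an environment Gamma is a
   list of types, variable v refers to the v-th entry of the current
   environment (Gamma followed by all enclosing lambda-binders, in order).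
   This gives canonical representatives of alpha-classes.  Infinite trees are
   coinductive; equality of NSPs is bisimilarity ([peq]). *)
From Stdlib Require Import List Arith PeanoNat ClassicalEpsilon.
Import ListNotations.
Open Scope nat_scope.

(* ---------- Types:  Arr [s0;...;s(r-1)] = s0,...,s(r-1) -> N ---------- *)
Inductive ty : Type := Arr : list ty -> ty.
Definition N : ty := Arr [].

Fixpoint lv (t : ty) : nat :=
  match t with
  | Arr ts => (fix go (l : list ty) : nat :=
                 match l with [] => 0 | s :: l' => Nat.max (S (lv s)) (go l') end) ts
  end.

(* ---------- NSPs ----------
   p ::= lam xs. e      e ::= bot | n | case (x q_0 ... q_{r-1}) of (i => e_i)
   (the arguments are given as a function, only indices < r are meaningful) *)
CoInductive proc : Type := Lam : list ty -> expr -> proc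
with expr : Type :=
| Bot : expr
| Num : nat -> expr
| Case : nat -> nat -> (nat -> proc) -> (nat -> expr) -> expr.

(* bisimilarity = equality of (alpha-classes of) NSP trees *)
CoInductive peq : proc -> proc -> Prop :=
| peq_lam : forall ts e e', eeq e e' -> peq (Lam ts e) (Lam ts e')
with eeq : expr -> expr -> Prop :=
| eeq_bot : eeq Bot Bot
| eeq_num : forall n, eeq (Num n) (Num n)
| eeq_case : forall x r Q Q' B B',
    (forall i, i < r -> peq (Q i) (Q' i)) -> (forall i, eeq (B i) (B' i)) ->
    eeq (Case x r Q B) (Case x r Q' B').

Definition ptype (p : proc) : ty := match p with Lam ts _ => Arr ts end.
Definition lam1 (s : ty) (p : proc) : proc :=
  match p with Lam ts e => Lam (s :: ts) e end.

CoFixpoint ren_p (f : nat -> nat) (p : proc) : proc :=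
  match p with Lam ts e => Lam ts (ren_e f e) end
with ren_e (f : nat -> nat) (e : expr) : expr :=
  match e with
  | Bot => Bot
  | Num n => Num n
  | Case x r Q B => Case (f x) r (fun i => ren_p f (Q i)) (fun i => ren_e f (B i))
  end.

Definition shift (base k : nat) (v : nat) : nat := if v <? base then v else v + k.

CoFixpoint repl_e (h : nat -> expr) (e : expr) : expr :=
  match e with
  | Bot => Bot
  | Num n => h n
  | Case x r Q B => Case x r Q (fun i => repl_e h (B i))
  end.
Definition repl_p (h : nat -> expr) (p : proc) : proc :=
  match p with Lam ts e => Lam ts (repl_e h e) end.

Definition opt_num (o : option nat) : expr :=
  match o with Some n => Num n | None => Bot end.

(* ---------- Meta-terms ----------
   mproc ::= lam xs. E      E ::= bot | n | case G of (i => E_i)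
   G ::= E | x Q_0...Q_{r-1} | P Q_0 ... Q_{r-1}                        *)
CoInductive mproc : Type := MLam : list ty -> mexpr -> mproc
with mexpr : Type :=
| MBot : mexpr
| MNum : nat -> mexpr
| MCase : mground -> (nat -> mexpr) -> mexpr
with mground : Type :=
| GE : mexpr -> mground
| GVar : nat -> nat -> (nat -> mproc) -> mground
| GApp : mproc -> nat -> (nat -> mproc) -> mground.

CoFixpoint embed_p (p : proc) : mproc :=
  match p with Lam ts e => MLam ts (embed_e e) end
with embed_e (e : expr) : mexpr :=
  match e with
  | Bot => MBot
  | Num n => MNum n
  | Case x r Q B => MCase (GVar x r (fun i => embed_p (Q i))) (fun i => embed_e (B i))
  end.

CoFixpoint mren_p (f : nat -> nat) (P : mproc) : mproc :=
  match P with MLam ts E => MLam ts (mren_e f E) end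
with mren_e (f : nat -> nat) (E : mexpr) : mexpr :=
  match E with
  | MBot => MBot
  | MNum n => MNum n
  | MCase G B => MCase (mren_g f G) (fun i => mren_e f (B i))
  end
with mren_g (f : nat -> nat) (G : mground) : mground :=
  match G with
  | GE E => GE (mren_e f E)
  | GVar x r Q => GVar (f x) r (fun i => mren_p f (Q i))
  | GApp P r Q => GApp (mren_p f P) r (fun i => mren_p f (Q i))
  end.

(* Substitution.  The source term lives in an environment of length n0
   (levels >= n0 are bound inside it), the result in one of length n1.
   A free level v < n0 is sent by s to a variable (SVar) or to a
   meta-procedure living in the target environment of length n1 (STm);
   bound levels v >= n0 become v - n0 + n1.  d is the current source depth. *)
Inductive sval : Type := SVar : nat -> sval | STm : mproc -> sval.

CoFixpoint sub_p (n0 n1 : nat) (s : nat -> sval) (d : nat) (P : mproc) : mproc :=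
  match P with MLam ts E => MLam ts (sub_e n0 n1 s (d + length ts) E) end
with sub_e (n0 n1 : nat) (s : nat -> sval) (d : nat) (E : mexpr) : mexpr :=
  match E with
  | MBot => MBot
  | MNum n => MNum n
  | MCase G B => MCase (sub_g n0 n1 s d G) (fun i => sub_e n0 n1 s d (B i))
  end
with sub_g (n0 n1 : nat) (s : nat -> sval) (d : nat) (G : mground) : mground :=
  match G with
  | GE E => GE (sub_e n0 n1 s d E)
  | GVar v r Q =>
      if v <? n0 then
        match s v with
        | SVar w => GVar w r (fun i => sub_p n0 n1 s d (Q i))
        | STm P => GApp (mren_p (shift n1 (d - n0)) P) r (fun i => sub_p n0 n1 s d (Q i))
        end
      else GVar (v - n0 + n1) r (fun i => sub_p n0 n1 s d (Q i))
  | GApp P r Q => GApp (sub_p n0 n1 s d P) r (fun i => sub_p n0 n1 s d (Q i))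
  end.

Definition hstep (d : nat) (E : mexpr) : option mexpr :=
  match E with
  | MCase G B =>
      match G with
      | GE MBot => Some MBot
      | GE (MNum n) => Some (B n)
      | GE (MCase G' B') => Some (MCase G' (fun i => MCase (GE (B' i)) B))
      | GVar _ _ _ => None
      | GApp (MLam ts E') r Q =>
          Some (MCase (GE (sub_e (d + length ts) d
                             (fun v => if v <? d then SVar v else STm (Q (v - d)))
                             (d + length ts) E')) B)
      end
  | _ => None
  end.

Fixpoint hred (d n : nat) (E : mexpr) : mexpr :=
  match n with
  | 0 => E
  | S n' => match hstep d E with None => E | Some E' => hred d n' E' end
  end.

Definition hnf (d : nat) (E : mexpr) : option mexpr :=
  match excluded_middle_informative (exists n, hstep d (hred d n E) = None) with
  | left H => Some (hred d (proj1_sig (constructive_indefinite_description _ H)) E)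
  | right _ => None
  end.

CoFixpoint nfe (d : nat) (E : mexpr) : expr :=
  match hnf d E with
  | Some (MNum n) => Num n
  | Some (MCase (GVar x r Q) B) => Case x r (fun i => nfp d (Q i)) (fun i => nfe d (B i))
  | _ => Bot
  end
with nfp (d : nat) (P : mproc) : proc :=
  match P with MLam ts E => Lam ts (nfe (d + length ts) E) end.

(* NSP application in an environment of length g:
   (lam x0 ... xr. e) . q = lam x1...xr. << e[x0 |-> q] >> *)
Definition app (g : nat) (p q : proc) : proc :=
  match p with
  | Lam (t :: ts) e =>
      Lam ts (nfe (g + length ts)
                (sub_e (g + 1) g (fun v => if v <? g then SVar v else STm (embed_p q))
                       (g + 1 + length ts) (embed_e e)))
  | _ => p
  end.

(* x^eta in an environment of length n, x of type s *)
CoFixpoint eta (n x : nat) (s : ty) : proc :=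
  match s with
  | Arr ts => Lam ts (Case x (length ts)
                         (fun j => eta (n + length ts) (n + j) (nth j ts N))
                         (fun i => Num i))
  end.

Definition dummy : nat -> proc := fun _ => Lam [] Bot.

(* F_sigma[g] in an environment of length n, g at level gv, sigma = Arr ts *)
CoFixpoint Fy (n gv : nat) (ts : list ty) : proc :=
  Lam ts (Case gv (S (length ts))
            (fun j => match j with
                      | 0 => Fy (n + length ts) gv ts
                      | S j' => eta (n + length ts) (n + j') (nth j' ts N)
                      end)
            (fun i => Num i)).

Inductive term : Type :=
| TVar : nat -> term
| TLam : ty -> term -> term
| TApp : term -> term -> term
| TNum : nat -> term
| TSuc | TPre | TIfz
| TY : ty -> term
| TC : (nat -> option nat) -> term.

Definition arrow (s t : ty) : ty := match t with Arr ts => Arr (s :: ts) end.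

Inductive has_type (k : nat) : list ty -> term -> ty -> Prop :=
| ht_var : forall G v, v < length G -> has_type k G (TVar v) (nth v G N)
| ht_lam : forall G s M t, has_type k (G ++ [s]) M t -> has_type k G (TLam s M) (arrow s t)
| ht_app : forall G M M' s ts,
    has_type k G M (Arr (s :: ts)) -> has_type k G M' s -> has_type k G (TApp M M') (Arr ts)
| ht_num : forall G n, has_type k G (TNum n) N
| ht_suc : forall G, has_type k G TSuc (Arr [N])
| ht_pre : forall G, has_type k G TPre (Arr [N])
| ht_ifz : forall G, has_type k G TIfz (Arr [N; N; N])
| ht_Y : forall G s, lv s <= k -> has_type k G (TY s) (arrow (arrow s s) s)
| ht_C : forall G f, has_type k G (TC f) (Arr [N]).

Fixpoint interp (G : list ty) (M : term) : proc :=
  let g := length G in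
  match M with
  | TVar v => eta g v (nth v G N)
  | TLam s M' => lam1 s (interp (G ++ [s]) M')
  | TApp M1 M2 => app g (interp G M1) (interp G M2)
  | TNum n => Lam [] (Num n)
  | TSuc => Lam [N] (Case g 0 dummy (fun i => Num (S i)))
  | TPre => Lam [N] (Case g 0 dummy (fun i => Num (pred i)))
  | TIfz => Lam [N; N; N]
              (Case g 0 dummy (fun i => match i with
                                        | 0 => Case (g + 1) 0 dummy (fun j => Num j)
                                        | S _ => Case (g + 2) 0 dummy (fun j => Num j)
                                        end))
  | TC f => Lam [N] (Case g 0 dummy (fun i => opt_num (f i)))
  | TY s => match s with
            | Arr ts => match Fy (g + 1) g ts with
                        | Lam _ e => Lam (arrow s s :: ts) e
                        end
            end
  end.

Definition denotable (k : nat) (G : list ty) (p : proc) : Prop :=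
  exists M t, has_type k G M t /\ peq p (interp G M).

CoFixpoint circ_p (lo hi : nat) (P : mproc) : mproc :=
  match P with MLam ts E => MLam ts (circ_e lo hi E) end
with circ_e (lo hi : nat) (E : mexpr) : mexpr :=
  match E with
  | MBot => MBot
  | MNum n => MNum n
  | MCase G B => MCase (circ_g lo hi G) (fun i => circ_e lo hi (B i))
  end
with circ_g (lo hi : nat) (G : mground) : mground :=
  match G with
  | GE E => GE (circ_e lo hi E)
  | GVar x r Q => if andb (lo <=? x) (x <? hi) then GE MBot
                  else GVar x r (fun i => circ_p lo hi (Q i))
  | GApp P r Q => GApp (circ_p lo hi P) r (fun i => circ_p lo hi (Q i))
  end.

(* supremum of an (increasing, w.r.t. the bot-approximation order) chain *)
Definition pick (P : nat -> Prop) : option nat :=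
  match excluded_middle_informative (exists m, P m) with
  | left H => Some (proj1_sig (constructive_indefinite_description _ H))
  | right _ => None
  end.

Definition is_mbot (E : mexpr) : bool := match E with MBot => true | _ => false end.
Definition is_GE (G : mground) : bool := match G with GE _ => true | _ => false end.
Definition caseG (E : mexpr) : mground := match E with MCase G _ => G | _ => GE MBot end.
Definition caseB (i : nat) (E : mexpr) : mexpr := match E with MCase _ B => B i | _ => MBot end.
Definition unGE (G : mground) : mexpr := match G with GE E => E | _ => MBot end.
Definition argG (i : nat) (G : mground) : mproc :=
  match G with GVar _ _ Q => Q i | GApp _ _ Q => Q i | GE _ => MLam [] MBot end.
Definition headP (G : mground) : mproc :=
  match G with GApp P _ _ => P | _ => MLam [] MBot end.
Definition binders (P : mproc) : list ty := match P with MLam ts _ => ts end.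
Definition body (P : mproc) : mexpr := match P with MLam _ E => E end.

CoFixpoint lub_e (c : nat -> mexpr) : mexpr :=
  match pick (fun m => is_mbot (c m) = false) with
  | None => MBot
  | Some m =>
      match c m with
      | MBot => MBot
      | MNum n => MNum n
      | MCase _ _ => MCase (lub_g (fun j => caseG (c (m + j))))
                           (fun i => lub_e (fun j => caseB i (c (m + j))))
      end
  end
with lub_g (c : nat -> mground) : mground :=
  match pick (fun m => is_GE (c m) = false) with
  | None => GE (lub_e (fun j => unGE (c j)))
  | Some m =>
      match c m with
      | GVar x r _ => GVar x r (fun i => lub_p (fun j => argG i (c (m + j))))
      | GApp _ r _ => GApp (lub_p (fun j => headP (c (m + j)))) r
                           (fun i => lub_p (fun j => argG i (c (m + j))))
      | GE _ => GE (lub_e (fun j => unGE (c (m + j))))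
      end
  end
with lub_p (c : nat -> mproc) : mproc :=
  MLam (binders (c 0)) (lub_e (fun j => body (c j))).

(* For Gamma of length g, Z = z, x_0..x_{r-1} (levels g .. g+r), e in Gamma,Z,
   xi(z) = lam xs. e  and  xi(x_i) = q_i  (all viewed in Gamma,Z).
   Returns  Pi_{Gamma,Z}(e, xi)  as a meta-expression in Gamma,Z. *)
Definition plug (g : nat) (ss : list ty) (e : expr) (qs : nat -> proc) : mexpr :=
  let r := length ss in
  let n := g + 1 + r in
  let xiz := MLam ss (mren_e (shift (g + 1) r) (embed_e e)) in
  let xix := fun i => mren_p (shift g (1 + r)) (embed_p (qs i)) in
  let s := fun v => if v <? g then SVar v
                    else if v =? g then STm xiz else STm (xix (v - g - 1)) in
  let Pi := fun m => Nat.iter m (sub_e n n s n) (embed_e e) in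
  lub_e (fun m => circ_e g n (Pi m)).

(* lam. << Pi_{Gamma,Z}(e, xi) >>, re-indexed as a procedure in Gamma *)
Definition plug_result (g : nat) (ss : list ty) (e : expr) (qs : nat -> proc) : proc :=
  let n := g + 1 + length ss in
  Lam [] (ren_e (fun v => if v <? g then v else v - n + g) (nfe n (plug g ss e qs))).

Inductive gen (k : nat) : list ty -> proc -> Prop :=
| gen_var : forall G x ts qs p,
    x < length G -> nth x G N = Arr ts ->
    (forall i, i < length ts -> gen k G (qs i) /\ ptype (qs i) = nth i ts N) ->
    peq p (Lam [] (Case x (length ts) qs (fun j => Num j))) ->
    gen k G p
| gen_lam : forall G s p p',
    gen k (G ++ [s]) p -> peq p' (lam1 s p) -> gen k G p'
| gen_num : forall G n p, peq p (Lam [] (Num n)) -> gen k G p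
| gen_fun : forall G p (f : nat -> option nat) p',
    gen k G p -> peq p' (repl_p (fun i => opt_num (f i)) p) -> gen k G p'
| gen_ifz : forall G ts e d e' p',
    gen k G (Lam ts e) -> gen k G (Lam [] d) -> gen k G (Lam [] e') ->
    peq p' (repl_p (fun i => match i with
                             | 0 => ren_e (shift (length G) (length ts)) d
                             | S _ => ren_e (shift (length G) (length ts)) e'
                             end) (Lam ts e)) ->
    gen k G p'
| gen_plug : forall G ss e qs p',
    lv (Arr ss) <= k ->
    gen k G (Lam (Arr ss :: ss) e) ->
    (forall i, i < length ss -> gen k G (qs i) /\ ptype (qs i) = nth i ss N) ->
    peq p' (plug_result (length G) ss e qs) ->
    gen k G p'.

(* Main.v *)
(* Procedures are run by a Krivine-style machine with closures; since variables are de Bruijn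
   levels, closures never need renaming, and a machine state has a typed normal form. The one fact
   about the machine that matters is that running the normal form of a state is running the state:
   a simulation proves it for code in which normal forms stand for what they are the normal forms
   of. Since [eta] is the normal form of a variable, [Fy] that of a recursive entry, and
   NSP application that of a call, it says how every interpreted term runs; [Pi] is the syntactic
   unfolding of the same recursive entry.
   Denotable procedures are generated by a Tait-style argument: an entry is computable if calling
   it with computable arguments yields a generated normal form; variables are computable by rule 1,
   computable entries reify by rule 2, and the constants are rules 3-6. Conversely, each rule is
   realised by an explicit term. *)
Require Import Defs.
From Stdlib Require Import List Arith Lia RelationClasses ClassicalEpsilon FunctionalExtensionality.
Import ListNotations.

(** * Lists *)

Lemma nth_error_lt {A} [l : list A] [i a] : nth_error l i = Some a -> i < length l.
Proof. intros H. apply nth_error_Some. congruence. Qed.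

Lemma nth_error_exists {A} (l : list A) i : i < length l -> exists a, nth_error l i = Some a.
Proof. intros H. destruct (nth_error l i) eqn:E; eauto. apply nth_error_None in E. lia. Qed.

Lemma nth_error_prefix {A} [l l' : list A] [i a] :
  nth_error l i = Some a -> nth_error (l ++ l') i = Some a.
Proof. intros H. rewrite nth_error_app1; [exact H | exact (nth_error_lt H)]. Qed.

Lemma nth_error_app_add {A} (l l' : list A) i :
  nth_error (l ++ l') (length l + i) = nth_error l' i.
Proof. rewrite nth_error_app2 by lia. f_equal. lia. Qed.

Lemma nth_error_middle {A} (l : list A) a l' : nth_error (l ++ a :: l') (length l) = Some a.
Proof. rewrite nth_error_app2, Nat.sub_diag by lia. reflexivity. Qed.

Lemma app_inj_length {A} (l1 l2 l1' l2' : list A) :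
  length l1 = length l2 -> l1 ++ l1' = l2 ++ l2' -> l1 = l2 /\ l1' = l2'.
Proof.
revert l2. induction l1 as [|a l1 IH]; intros [|b l2]; try discriminate; [auto|].
intros [= Hl] [= -> H]. destruct (IH l2 Hl H) as [-> ->]. auto.
Qed.

Lemma map_nth_seq {A} (l : list A) (default : nat -> A) :
  map (fun i => nth i l (default i)) (seq 0 (length l)) = l.
Proof.
apply nth_error_ext. intros i. rewrite nth_error_map, nth_error_seq.
destruct (Nat.ltb_spec i (length l)) as [Hi|Hi]; simpl.
- symmetry. apply nth_error_nth'. exact Hi.
- symmetry. apply nth_error_None. exact Hi.
Qed.

Lemma map_seq_shift {A} (f : nat -> A) d k :
  map f (seq d k) = map (fun i => f (d + i)) (seq 0 k).
Proof.
apply nth_error_ext. intros i. rewrite !nth_error_map, !nth_error_seq.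
destruct (i <? k); reflexivity.
Qed.

Lemma Forall2_nth_error_l {A B} [R : A -> B -> Prop] [l l' i a] :
  Forall2 R l l' -> nth_error l i = Some a -> exists b, nth_error l' i = Some b /\ R a b.
Proof.
intros H. revert i. induction H as [|x y l l' Hxy _ IH]; intros [|i] Ha; try discriminate.
- injection Ha as <-. exists y. auto.
- exact (IH i Ha).
Qed.

Lemma Forall2_nth {A B} [R : A -> B -> Prop] [l l' i] a b :
  Forall2 R l l' -> i < length l -> R (nth i l a) (nth i l' b).
Proof.
intros H. revert i. induction H as [|x y l l' Hxy _ IH]; intros [|i] Hi; simpl in *;
  [lia | lia | exact Hxy | apply IH; lia].
Qed.

Lemma map_ext_Forall2 {A B C} (f g : B -> C) (l : list A) l' :
  Forall2 (fun _ b => f b = g b) l l' -> map f l' = map g l'.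
Proof. induction 1; simpl; congruence. Qed.

Lemma Forall2_map_seq {A B} (R : A -> B -> Prop) (f : nat -> B) l d :
  (forall i a, nth_error l i = Some a -> R a (f (d + i))) ->
  Forall2 R l (map f (seq d (length l))).
Proof.
revert d. induction l as [|a l IH]; intros d H; simpl; constructor.
- rewrite <- (Nat.add_0_r d). apply H. reflexivity.
- apply IH. intros i b Hb. rewrite Nat.add_succ_comm. apply H. exact Hb.
Qed.

Lemma Forall2_map_l {A B C} (R : B -> C -> Prop) (f : A -> B) l l' :
  Forall2 R (map f l) l' <-> Forall2 (fun a => R (f a)) l l'.
Proof.
revert l'. induction l as [|a l IH]; intros l'; split; inversion 1; subst; constructor; auto;
  apply IH; assumption.
Qed.

(** * Bisimilarity *)

Lemma peq_inv ts e p : peq (Lam ts e) p -> exists e', p = Lam ts e' /\ eeq e e'.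
Proof. inversion 1; eauto. Qed.

Lemma peq_Lam_inv ts e ts' e' : peq (Lam ts e) (Lam ts' e') -> ts = ts' /\ eeq e e'.
Proof. inversion 1; auto. Qed.

Lemma peq_refl p : peq p p with eeq_refl e : eeq e e.
Proof.
- destruct p; constructor; apply eeq_refl.
- destruct e; constructor; intros; [apply peq_refl | apply eeq_refl].
Qed.

Lemma peq_sym p p' : peq p p' -> peq p' p with eeq_sym e e' : eeq e e' -> eeq e' e.
Proof.
- destruct 1; constructor; apply eeq_sym; assumption.
- destruct 1 as [| |x r Q Q' B B' HQ HB]; constructor; intros i;
    [intros Hi; apply peq_sym, (HQ i Hi) | apply eeq_sym, HB].
Qed.

Lemma peq_trans p q r : peq p q -> peq q r -> peq p r
with eeq_trans e f h : eeq e f -> eeq f h -> eeq e h.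
Proof.
- destruct 1; inversion 1; subst; constructor; eapply eeq_trans; eassumption.
- destruct 1 as [| |x r Q Q' B B' HQ HB]; inversion 1 as [| |? ? ? Q2 ? B2 HQ2 HB2]; subst;
    constructor; intros i;
    [intros Hi; apply (peq_trans _ (Q' i) _); [apply (HQ i Hi) | apply (HQ2 i Hi)]
    |apply (eeq_trans _ (B' i) _); [apply HB | apply HB2]].
Qed.

#[local] Instance peq_equivalence : Equivalence peq.
Proof. split; red; eauto using peq_refl, peq_sym, peq_trans. Qed.

#[local] Instance eeq_equivalence : Equivalence eeq.
Proof. split; red; eauto using eeq_refl, eeq_sym, eeq_trans. Qed.

(* Rewriting with these forces one unfolding of a corecursive definition. *)
Lemma expr_eta e :
  e = match e with Bot => Bot | Num n => Num n | Case x r Q B => Case x r Q B end.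
Proof. destruct e; reflexivity. Qed.

Lemma proc_eta p : p = match p with Lam ts e => Lam ts e end.
Proof. destruct p; reflexivity. Qed.

Lemma ren_e_eq f e : ren_e f e =
  match e with
  | Bot => Bot
  | Num n => Num n
  | Case x r Q B => Case (f x) r (fun i => ren_p f (Q i)) (fun i => ren_e f (B i))
  end.
Proof. rewrite (expr_eta (ren_e f e)). destruct e; reflexivity. Qed.

Lemma ren_p_eq f ts e : ren_p f (Lam ts e) = Lam ts (ren_e f e).
Proof. rewrite (proc_eta (ren_p f (Lam ts e))). reflexivity. Qed.

Lemma repl_e_eq h e : repl_e h e =
  match e with
  | Bot => Bot
  | Num n => h n
  | Case x r Q B => Case x r Q (fun i => repl_e h (B i))
  end.
Proof.
rewrite (expr_eta (repl_e h e)). destruct e as [|n|]; try reflexivity.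
simpl. destruct (h n); reflexivity.
Qed.

Lemma eta_eq n x ts : eta n x (Arr ts) =
  Lam ts (Case x (length ts) (fun j => eta (n + length ts) (n + j) (nth j ts N)) (fun i => Num i)).
Proof. rewrite (proc_eta (eta n x (Arr ts))). reflexivity. Qed.

Definition Fy_arg (n gv : nat) (ts : list ty) (j : nat) : proc :=
  match j with
  | 0 => Fy (n + length ts) gv ts
  | S j' => eta (n + length ts) (n + j') (nth j' ts N)
  end.

Lemma Fy_eq n gv ts : Fy n gv ts =
  Lam ts (Case gv (S (length ts)) (Fy_arg n gv ts) (fun i => Num i)).
Proof. rewrite (proc_eta (Fy n gv ts)). reflexivity. Qed.

Lemma ren_e_eeq f e e' : eeq e e' -> eeq (ren_e f e) (ren_e f e')
with ren_p_peq f p p' : peq p p' -> peq (ren_p f p) (ren_p f p').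
Proof.
- destruct 1 as [| |x r Q Q' B B' HQ HB]; rewrite !(ren_e_eq f); constructor.
  + intros i Hi. apply ren_p_peq. exact (HQ i Hi).
  + intros i. apply ren_e_eeq. exact (HB i).
- destruct 1. rewrite !ren_p_eq. constructor. apply ren_e_eeq. assumption.
Qed.

Lemma ren_e_cancel f g e : (forall v, f (g v) = v) -> eeq (ren_e f (ren_e g e)) e.
Proof.
intros Hfg. revert e. cofix IH. intros e.
rewrite (ren_e_eq g). destruct e as [|n|x r Q B]; rewrite ren_e_eq; try constructor.
rewrite Hfg. constructor.
- intros i _. destruct (Q i) as [ts e]. rewrite !ren_p_eq. constructor. apply IH.
- intros i. apply IH.
Qed.

Lemma ren_e_id f e : (forall v, f v = v) -> eeq (ren_e f e) e.
Proof.
intros Hf. revert e. cofix IH. intros e. rewrite ren_e_eq.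
destruct e as [|n|x r Q B]; try constructor. rewrite Hf. constructor.
- intros i _. destruct (Q i) as [ts e]. rewrite ren_p_eq. constructor. apply IH.
- intros i. apply IH.
Qed.

Lemma repl_e_eeq h h' e e' : (forall i, eeq (h i) (h' i)) -> eeq e e' ->
  eeq (repl_e h e) (repl_e h' e').
Proof.
intros Hh. revert e e'. cofix IH. intros e e' He.
rewrite !(repl_e_eq _ e), !(repl_e_eq _ e').
destruct He as [|n|x r Q Q' B B' HQ HB]; [constructor | apply Hh |].
constructor; [exact HQ|]. intros i. apply IH, HB.
Qed.

Lemma shift_lt n k v : v < n -> shift n k v = v.
Proof. intros H. unfold shift. apply Nat.ltb_lt in H. rewrite H. reflexivity. Qed.

Lemma shift_ge n k v : n <= v -> shift n k v = v + k.
Proof. intros H. unfold shift. apply Nat.ltb_ge in H. rewrite H. reflexivity. Qed.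

Lemma shift_0 n v : shift n 0 v = v.
Proof. unfold shift. destruct (v <? n); lia. Qed.

(** * The abstract machine *)

(* The recursive entry [Rec f], when called, passes itself to [f] as first argument. *)
Inductive entry : Type :=
| Var : nat -> entry
| Clo : proc -> list entry -> entry
| Rec : entry -> entry.

Lemma entry_ind_nested (P : entry -> Prop) :
  (forall w, P (Var w)) ->
  (forall p rho, Forall P rho -> P (Clo p rho)) ->
  (forall f, P f -> P (Rec f)) ->
  forall a, P a.
Proof.
intros HV HC HR. fix IH 1. intros [w | p rho | f]; [apply HV | apply HC | apply HR, IH].
induction rho; constructor; auto.
Qed.

Definition frame : Type := (nat -> expr) * list entry.

Inductive state : Type :=
| Eval : expr -> list entry -> list frame -> state
| Call : entry -> list entry -> list frame -> state
| Ret : nat -> list frame -> state.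

Definition vars (d k : nat) : list entry := map Var (seq d k).

Local Notation id_env D := (vars 0 (length D)).
Local Notation fresh D us := (vars (length D) (length us)).

Definition closures (r : nat) (Q : nat -> proc) (rho : list entry) : list entry :=
  map (fun i => Clo (Q i) rho) (seq 0 r).

Definition step (s : state) : option state :=
  match s with
  | Eval Bot _ _ => None
  | Eval (Num n) _ K => Some (Ret n K)
  | Eval (Case x r Q B) rho K =>
      match nth_error rho x with
      | Some a => Some (Call a (closures r Q rho) ((B, rho) :: K))
      | None => None
      end
  | Call (Var _) _ _ => None
  | Call (Clo (Lam _ e) rho) bs K => Some (Eval e (rho ++ bs) K)
  | Call (Rec f) bs K => Some (Call f (Rec f :: bs) K)
  | Ret _ [] => None
  | Ret n ((B, rho) :: K) => Some (Eval (B n) rho K)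
  end.

Definition is_value (s : state) : Prop :=
  match s with
  | Call (Var _) _ _ => True
  | Ret _ [] => True
  | _ => False
  end.

Definition is_stuck (s : state) : Prop := step s = None /\ ~ is_value s.

Inductive steps : nat -> state -> state -> Prop :=
| steps_0 : forall s, steps 0 s s
| steps_S : forall n s s1 s2, step s = Some s1 -> steps n s1 s2 -> steps (S n) s s2.

Definition evaluates (n : nat) (s v : state) : Prop := steps n s v /\ is_value v.

Definition converges (s v : state) : Prop := exists n, evaluates n s v.

Lemma length_vars d k : length (vars d k) = k.
Proof. unfold vars. rewrite length_map, length_seq. reflexivity. Qed.

Lemma vars_app d k l : vars d k ++ vars (d + k) l = vars d (k + l).
Proof. unfold vars. rewrite seq_app, map_app. reflexivity. Qed.

Lemma nth_error_vars d k i : i < k -> nth_error (vars d k) i = Some (Var (d + i)).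
Proof.
intros H. unfold vars. rewrite nth_error_map, nth_error_seq.
apply Nat.ltb_lt in H. rewrite H. reflexivity.
Qed.

Lemma nth_vars d k i a : i < k -> nth i (vars d k) a = Var (d + i).
Proof. intros H. apply nth_error_nth, nth_error_vars, H. Qed.

Lemma nth_error_vars_app d k l i : nth_error (vars d k ++ l) (k + i) = nth_error l i.
Proof. rewrite <- (length_vars d k) at 2. apply nth_error_app_add. Qed.

Lemma length_closures r Q rho : length (closures r Q rho) = r.
Proof. unfold closures. rewrite length_map, length_seq. reflexivity. Qed.

Lemma nth_error_closures r Q rho i : i < r -> nth_error (closures r Q rho) i = Some (Clo (Q i) rho).
Proof.
intros H. unfold closures. rewrite nth_error_map, nth_error_seq.
apply Nat.ltb_lt in H. rewrite H. reflexivity.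
Qed.

Lemma nth_closures r Q rho i a : i < r -> nth i (closures r Q rho) a = Clo (Q i) rho.
Proof. intros H. apply nth_error_nth, nth_error_closures, H. Qed.

Lemma closures_S r Q rho :
  closures (S r) Q rho = Clo (Q 0) rho :: closures r (fun i => Q (S i)) rho.
Proof. unfold closures. simpl. rewrite <- seq_shift, map_map. reflexivity. Qed.

Lemma state_cases s : is_value s \/ is_stuck s \/ exists s', step s = Some s'.
Proof.
unfold is_stuck. destruct (step s) eqn:E; [eauto|].
destruct s as [| [] | ? []]; simpl; auto.
Qed.

Lemma value_no_step [v] : is_value v -> step v = None.
Proof. destruct v as [| [] | ? []]; simpl; tauto. Qed.

Lemma steps_1 [s s'] : step s = Some s' -> steps 1 s s'.
Proof. intros H. econstructor; [exact H | constructor]. Qed.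

Lemma steps_trans [j s s1 k s2] : steps j s s1 -> steps k s1 s2 -> steps (j + k) s s2.
Proof. induction 1; simpl; auto. intros. econstructor; eauto. Qed.

Lemma evaluates_steps [j s s' n v] : steps j s s' -> evaluates n s v ->
  exists m, n = j + m /\ evaluates m s' v.
Proof.
intros Hj [Hv Hval]. revert n Hv.
induction Hj as [s | j s s1 s2 Hs _ IH]; intros n Hv; [exists n; repeat split; auto|].
inversion Hv as [|m s0 s1' v0 Hs' Hm]; subst.
- rewrite (value_no_step Hval) in Hs. discriminate.
- rewrite Hs in Hs'. injection Hs' as <-. destruct (IH m Hm) as (k & -> & Hk). exists k. auto.
Qed.

Lemma converges_steps [j s s'] v : steps j s s' -> (converges s v <-> converges s' v).
Proof.
intros Hs. split; intros [n Hv].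
- destruct (evaluates_steps Hs Hv) as (m & _ & Hm). exists m. exact Hm.
- destruct Hv as [Hn Hval]. exists (j + n). split; [eapply steps_trans; eauto | exact Hval].
Qed.

Lemma converges_value s : is_value s -> converges s s.
Proof. intros H. exists 0. split; [constructor | exact H]. Qed.

Lemma converges_unique [s v w] : converges s v -> converges s w -> v = w.
Proof.
intros [n [Hv Hval]] Hw. apply (converges_steps _ Hv) in Hw. destruct Hw as [m [Hw _]].
inversion Hw as [|? ? ? ? Hs]; auto. rewrite (value_no_step Hval) in Hs. discriminate.
Qed.

Lemma stuck_diverges s v : is_stuck s -> ~ converges s v.
Proof.
intros [Hs Hval] (n & Hn & Hv). destruct Hn as [|? ? ? ? Hs']; [auto | congruence].
Qed.

Definition value (s : state) : option state :=
  match excluded_middle_informative (exists v, converges s v) with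
  | left H => Some (proj1_sig (constructive_indefinite_description _ H))
  | right _ => None
  end.

Lemma value_converges [s v] : converges s v -> value s = Some v.
Proof.
intros H. unfold value. destruct excluded_middle_informative as [H' | H']; [|destruct H'; eauto].
destruct constructive_indefinite_description as [w Hw]; simpl.
f_equal. exact (converges_unique Hw H).
Qed.

Lemma value_diverges s : (forall v, ~ converges s v) -> value s = None.
Proof.
intros H. unfold value. destruct excluded_middle_informative as [[v Hv] | _]; [|reflexivity].
destruct (H v Hv).
Qed.

Lemma converges_or_diverges s : (exists v, converges s v) \/ (forall v, ~ converges s v).
Proof. destruct (excluded_middle_informative (exists v, converges s v)); eauto. Qed.

Lemma value_steps [j s s'] : steps j s s' -> value s = value s'.
Proof.
intros Hs. destruct (converges_or_diverges s') as [[v Hv] | Hdiv].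
- rewrite (value_converges Hv). apply value_converges.
  apply (converges_steps _ Hs). exact Hv.
- rewrite (value_diverges s' Hdiv). apply value_diverges. intros v Hv.
  apply (Hdiv v), (converges_steps _ Hs), Hv.
Qed.

(** * Normal forms of machine states *)

CoFixpoint nf (D : list ty) (s : state) : expr :=
  match value s with
  | Some (Ret n _) => Num n
  | Some (Call (Var w) bs K) =>
      match nth w D N with
      | Arr ts =>
          Case w (length ts) (fun i => nf_entry D (nth i ts N) (nth i bs (Var 0)))
            (fun i => nf D (Ret i K))
      end
  | _ => Bot
  end
with nf_entry (D : list ty) (t : ty) (a : entry) : proc :=
  match t with
  | Arr us => Lam us (nf (D ++ us) (Call a (fresh D us) []))
  end.

Lemma nf_entry_eq D us a :
  nf_entry D (Arr us) a = Lam us (nf (D ++ us) (Call a (fresh D us) [])).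
Proof. rewrite (proc_eta (nf_entry D (Arr us) a)). reflexivity. Qed.

Lemma ptype_nf_entry D t a : ptype (nf_entry D t a) = t.
Proof. destruct t. rewrite nf_entry_eq. reflexivity. Qed.

Lemma nf_steps [D j s s'] : steps j s s' -> nf D s = nf D s'.
Proof.
intros H. rewrite (expr_eta (nf D s)), (expr_eta (nf D s')). simpl.
rewrite (value_steps H). reflexivity.
Qed.

Lemma nf_step D s s' : step s = Some s' -> nf D s = nf D s'.
Proof. intros H. exact (nf_steps (steps_1 H)). Qed.

Lemma nf_diverges D s : (forall v, ~ converges s v) -> nf D s = Bot.
Proof.
intros H. rewrite (expr_eta (nf D s)). simpl. rewrite value_diverges by exact H. reflexivity.
Qed.

Lemma nf_converges [D s v] : converges s v -> nf D s = nf D v.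
Proof. intros (n & Hn & _). exact (nf_steps Hn). Qed.

Lemma nf_Ret_nil D n : nf D (Ret n []) = Num n.
Proof.
rewrite (expr_eta (nf D (Ret n []))). simpl.
rewrite (value_converges (v := Ret n [])) by (apply converges_value; exact I). reflexivity.
Qed.

Lemma nf_Eval_Bot D rho K : nf D (Eval Bot rho K) = Bot.
Proof.
apply nf_diverges. intros v. apply stuck_diverges. split; [reflexivity | exact (fun H => H)].
Qed.

Lemma nf_Eval_Num D n rho : nf D (Eval (Num n) rho []) = Num n.
Proof. rewrite (nf_step _ _ (Ret n [])) by reflexivity. apply nf_Ret_nil. Qed.

Lemma nf_Call_Var [D w bs K ts] : nth_error D w = Some (Arr ts) ->
  nf D (Call (Var w) bs K) =
  Case w (length ts) (fun i => nf_entry D (nth i ts N) (nth i bs (Var 0)))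
    (fun i => nf D (Ret i K)).
Proof.
intros H. rewrite (expr_eta (nf D (Call (Var w) bs K))). simpl.
rewrite (value_converges (v := Call (Var w) bs K)) by (apply converges_value; exact I).
rewrite (nth_error_nth _ _ _ H). reflexivity.
Qed.

(** * Typing *)

CoInductive typed_p : list ty -> proc -> ty -> Prop :=
| typed_Lam : forall G ts e, typed_e (G ++ ts) e -> typed_p G (Lam ts e) (Arr ts)
with typed_e : list ty -> expr -> Prop :=
| typed_Bot : forall G, typed_e G Bot
| typed_Num : forall G n, typed_e G (Num n)
| typed_Case : forall G x ts Q B,
    nth_error G x = Some (Arr ts) ->
    (forall i t, nth_error ts i = Some t -> typed_p G (Q i) t) ->
    (forall i, typed_e G (B i)) ->
    typed_e G (Case x (length ts) Q B).

Inductive typed_entry (D : list ty) : ty -> entry -> Prop :=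
| typed_Var : forall w t, nth_error D w = Some t -> typed_entry D t (Var w)
| typed_Clo : forall G t p rho,
    typed_p G p t -> Forall2 (typed_entry D) G rho -> typed_entry D t (Clo p rho)
| typed_Rec : forall ss f, typed_entry D (Arr (Arr ss :: ss)) f -> typed_entry D (Arr ss) (Rec f).

Lemma typed_entry_ind_nested D (P : ty -> entry -> Prop) :
  (forall w t, nth_error D w = Some t -> P t (Var w)) ->
  (forall G t p rho, typed_p G p t -> Forall2 (typed_entry D) G rho -> Forall2 P G rho ->
    P t (Clo p rho)) ->
  (forall ss f, P (Arr (Arr ss :: ss)) f -> P (Arr ss) (Rec f)) ->
  forall t a, typed_entry D t a -> P t a.
Proof.
intros HV HC HR. fix IH 3. intros t a [w t' Hw | G t' p rho Hp Hrho | ss f Hf].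
- apply HV, Hw.
- apply (HC G); auto. clear Hp. induction Hrho; constructor; auto.
- apply HR, IH, Hf.
Qed.

Definition typed_env (D : list ty) : list ty -> list entry -> Prop := Forall2 (typed_entry D).

Definition typed_stack (D : list ty) : list frame -> Prop :=
  Forall (fun F => exists G, typed_env D G (snd F) /\ forall i, typed_e G (fst F i)).

Inductive typed_state (D : list ty) : state -> Prop :=
| typed_Eval : forall G e rho K,
    typed_e G e -> typed_env D G rho -> typed_stack D K -> typed_state D (Eval e rho K)
| typed_Call : forall ts a bs K,
    typed_entry D (Arr ts) a -> typed_env D ts bs -> typed_stack D K -> typed_state D (Call a bs K)
| typed_Ret : forall n K, typed_stack D K -> typed_state D (Ret n K).

Lemma typed_peq G p p' t : typed_p G p t -> peq p p' -> typed_p G p' t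
with typed_eeq G e e' : typed_e G e -> eeq e e' -> typed_e G e'.
Proof.
- destruct 1; inversion 1; subst. constructor. eapply typed_eeq; eassumption.
- destruct 1 as [| |G x ts Q B Hx HQ HB]; inversion 1 as [| |? ? ? Q' ? B' HQ' HB']; subst.
  + constructor.
  + constructor.
  + econstructor.
    * exact Hx.
    * intros i t Hi. apply (typed_peq _ (Q i)); [exact (HQ i t Hi)|].
      apply HQ'. exact (nth_error_lt Hi).
    * intros i. apply (typed_eeq _ (B i)); [apply HB | apply HB'].
Qed.

Lemma typed_Var_inv [D t w] : typed_entry D t (Var w) -> nth_error D w = Some t.
Proof. inversion 1; assumption. Qed.

Lemma typed_Lam_inv [G ts e t] : typed_p G (Lam ts e) t -> t = Arr ts /\ typed_e (G ++ ts) e.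
Proof. inversion 1; auto. Qed.

Lemma typed_ptype [G p t] : typed_p G p t -> ptype p = t.
Proof. destruct 1; reflexivity. Qed.

Lemma typed_closures [D G Q rho ts] :
  (forall i t, nth_error ts i = Some t -> typed_p G (Q i) t) -> typed_env D G rho ->
  typed_env D ts (closures (length ts) Q rho).
Proof.
intros HQ Hrho. apply Forall2_map_seq. intros i t Ht. exact (typed_Clo _ _ _ _ _ (HQ i t Ht) Hrho).
Qed.

Lemma typed_fresh G us : typed_env (G ++ us) us (fresh G us).
Proof.
apply Forall2_map_seq. intros i u Hu. constructor. rewrite nth_error_app_add. exact Hu.
Qed.

Lemma typed_id_env D : typed_env D D (id_env D).
Proof. exact (typed_fresh [] D). Qed.

Lemma typed_entry_weaken [D D' t a] : typed_entry D t a -> typed_entry (D ++ D') t a.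
Proof.
revert t a. apply typed_entry_ind_nested.
- intros. constructor. apply nth_error_prefix. assumption.
- intros. econstructor; eassumption.
- intros. constructor. assumption.
Qed.

Lemma typed_env_weaken [D D' G rho] : typed_env D G rho -> typed_env (D ++ D') G rho.
Proof. apply Forall2_impl. intros. apply typed_entry_weaken. assumption. Qed.

Lemma typed_stack_nil D : typed_stack D [].
Proof. constructor. Qed.

Lemma typed_step [D s s'] : typed_state D s -> step s = Some s' -> typed_state D s'.
Proof.
destruct 1 as [G e rho K He Hrho HK | ts a bs K Ha Hbs HK | n K HK]; simpl; intros Hs.
- destruct He as [| |G x ts Q B Hx HQ HB]; [discriminate | |].
  + injection Hs as <-. constructor. exact HK.
  + destruct (Forall2_nth_error_l Hrho Hx) as (a & Ha & Hta). rewrite Ha in Hs.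
    injection Hs as <-. econstructor; [exact Hta | exact (typed_closures HQ Hrho)|].
    constructor; [exists G; auto | exact HK].
- inversion Ha as [w t Hw | G t [us e] rho Hp Hrho | ss f Hf]; subst; [discriminate | |];
    injection Hs as <-.
  + inversion Hp; subst. econstructor; [eassumption | exact (Forall2_app Hrho Hbs) | exact HK].
  + econstructor; [exact Hf | | exact HK]. constructor; [exact Ha | exact Hbs].
- destruct HK as [|[B rho] K (G & Hrho & HB) HK]; [discriminate|]. injection Hs as <-.
  econstructor; [apply HB | exact Hrho | exact HK].
Qed.

Lemma typed_steps [D j s s'] : steps j s s' -> typed_state D s -> typed_state D s'.
Proof. induction 1; eauto using typed_step. Qed.

Lemma typed_nf D s : typed_state D s -> typed_e D (nf D s)
with typed_nf_entry D t a : typed_entry D t a -> typed_p D (nf_entry D t a) t.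
Proof.
- intros Hs. destruct (converges_or_diverges s) as [[v (n & Hn & Hval)] | Hdiv];
    [|rewrite nf_diverges by exact Hdiv; constructor].
  rewrite (nf_steps Hn). apply (typed_steps Hn) in Hs. clear Hn.
  destruct Hs as [| ts [w | |] bs K Ha Hbs HK | k [|]]; try contradiction.
  + apply typed_Var_inv in Ha. rewrite (nf_Call_Var Ha). constructor; [exact Ha | |].
    * intros i t Ht. rewrite (nth_error_nth _ _ _ Ht).
      destruct (Forall2_nth_error_l Hbs Ht) as (b & Hb & Htb).
      rewrite (nth_error_nth _ _ _ Hb). apply typed_nf_entry. exact Htb.
    * intros i. apply typed_nf. constructor. exact HK.
  + rewrite nf_Ret_nil. constructor.
- intros Ha. destruct t as [us]. rewrite nf_entry_eq. constructor. apply typed_nf. econstructor.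
  + apply typed_entry_weaken. exact Ha.
  + apply typed_fresh.
  + constructor.
Qed.

(** * Instantiating the variables of a state *)

Fixpoint esub (th : nat -> entry) (a : entry) : entry :=
  match a with
  | Var w => th w
  | Clo p rho => Clo p (map (esub th) rho)
  | Rec f => Rec (esub th f)
  end.

Definition fsub (th : nat -> entry) (F : frame) : frame := (fst F, map (esub th) (snd F)).

Definition inst (th : nat -> entry) (K' : list frame) (s : state) : state :=
  match s with
  | Eval e rho K => Eval e (map (esub th) rho) (map (fsub th) K ++ K')
  | Call a bs K => Call (esub th a) (map (esub th) bs) (map (fsub th) K ++ K')
  | Ret n K => Ret n (map (fsub th) K ++ K')
  end.

(* Variables below [length rho] are looked up in [rho]; the remaining ones are bound further
   inside, and are renumbered to start at [n]. *)
Definition assign (rho : list entry) (n v : nat) : entry := nth v rho (Var (v - length rho + n)).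

Lemma assign_nth_error [rho n v a] : nth_error rho v = Some a -> assign rho n v = a.
Proof. apply nth_error_nth. Qed.

Lemma assign_ge rho n v : length rho <= v -> assign rho n v = Var (v - length rho + n).
Proof. apply nth_overflow. Qed.

Lemma map_esub_vars th d k : map (esub th) (vars d k) = map th (seq d k).
Proof. unfold vars. rewrite map_map. reflexivity. Qed.

Lemma map_esub_vars_shift th d d' k : (forall i, th (d + i) = Var (d' + i)) ->
  map (esub th) (vars d k) = vars d' k.
Proof.
intros H. rewrite map_esub_vars. unfold vars. rewrite map_seq_shift, (map_seq_shift Var).
apply map_ext, H.
Qed.

Lemma map_esub_closures th r Q rho :
  map (esub th) (closures r Q rho) = closures r Q (map (esub th) rho).
Proof. unfold closures. rewrite map_map. reflexivity. Qed.

Lemma map_assign_vars rho n : map (esub (assign rho n)) (vars 0 (length rho)) = rho.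
Proof. rewrite map_esub_vars. apply (map_nth_seq rho). Qed.

Lemma map_assign_vars_app rho bs n :
  map (esub (assign (rho ++ bs) n)) (vars 0 (length rho)) = rho /\
  map (esub (assign (rho ++ bs) n)) (vars (length rho) (length bs)) = bs.
Proof.
apply app_inj_length; [rewrite length_map, length_vars; reflexivity|].
rewrite <- map_app, (vars_app 0), <- length_app. apply map_assign_vars.
Qed.

Lemma map_assign_vars_ge rho n d k : length rho <= d ->
  map (esub (assign rho n)) (vars d k) = vars (d - length rho + n) k.
Proof.
intros H. apply map_esub_vars_shift. intros i. rewrite assign_ge by lia. f_equal. lia.
Qed.

Lemma map_assign_vars_add rho n k :
  map (esub (assign rho n)) (vars 0 (length rho + k)) = rho ++ vars n k.
Proof.
rewrite <- (vars_app 0), map_app, map_assign_vars, map_assign_vars_ge by apply Nat.le_refl.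
simpl. rewrite Nat.sub_diag. reflexivity.
Qed.

Lemma map_assign_vars_firstn rho k l d : k <= length rho <= d ->
  map (esub (assign rho (length rho))) (vars 0 k ++ vars d l) = firstn k rho ++ vars d l.
Proof.
intros [Hk Hd]. rewrite map_app, (map_assign_vars_ge _ _ d), Nat.sub_add by exact Hd. f_equal.
assert (Hl : length (firstn k rho) = k) by (rewrite length_firstn; lia).
pose proof (map_assign_vars_app (firstn k rho) (skipn k rho) (length rho)) as [E _].
rewrite firstn_skipn, Hl in E. exact E.
Qed.

Lemma esub_Var a : esub Var a = a.
Proof.
induction a as [w | p rho IH | f IH] using entry_ind_nested; simpl; f_equal; auto.
induction IH; simpl; congruence.
Qed.

Lemma esub_ext [D t a th th'] : typed_entry D t a -> (forall w, w < length D -> th w = th' w) ->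
  esub th a = esub th' a.
Proof.
intros Ha Hth. revert t a Ha. apply typed_entry_ind_nested; simpl.
- intros w t Hw. apply Hth. exact (nth_error_lt Hw).
- intros G t p rho _ _ IH. f_equal. exact (map_ext_Forall2 _ _ _ _ IH).
- intros ss f IH. congruence.
Qed.

Lemma esub_id [D t a th] : typed_entry D t a -> (forall w, w < length D -> th w = Var w) ->
  esub th a = a.
Proof. intros Ha Hth. rewrite <- (esub_Var a) at 2. exact (esub_ext Ha Hth). Qed.

Lemma map_esub_id [D G rho th] : typed_env D G rho -> (forall w, w < length D -> th w = Var w) ->
  map (esub th) rho = rho.
Proof.
intros Hrho Hth. rewrite <- (map_id rho) at 2. apply (map_ext_Forall2 _ _ G).
eapply Forall2_impl; [|exact Hrho]. intros t a Ha. exact (esub_id Ha Hth).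
Qed.

Lemma assign_vars d n w : w < d -> assign (vars 0 d) n w = Var w.
Proof. intros H. apply assign_nth_error, (nth_error_vars 0), H. Qed.

Lemma inst_id D s K : typed_state D s ->
  inst (assign (id_env D) 0) K s =
  match s with
  | Eval e rho K0 => Eval e rho (K0 ++ K)
  | Call a bs K0 => Call a bs (K0 ++ K)
  | Ret n K0 => Ret n (K0 ++ K)
  end.
Proof.
assert (Hth : forall w, w < length D -> assign (id_env D) 0 w = Var w)
  by (intros w; apply assign_vars).
assert (Hstack : forall K0, typed_stack D K0 ->
  map (fsub (assign (id_env D) 0)) K0 = K0).
{ induction 1 as [|[B rho] K0 (G & Hrho & _) _ IH]; [reflexivity|].
  simpl. rewrite IH. unfold fsub. simpl in *. rewrite (map_esub_id Hrho Hth).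
  reflexivity. }
intros [G e rho K0 _ Hrho HK | ts a bs K0 Ha Hbs HK | n K0 HK]; simpl; rewrite (Hstack _ HK);
  [rewrite (map_esub_id Hrho Hth)
  |rewrite (esub_id Ha Hth), (map_esub_id Hbs Hth) |]; reflexivity.
Qed.

Lemma step_inst th K s s' : step s = Some s' -> step (inst th K s) = Some (inst th K s').
Proof.
destruct s as [e rho K0 | a bs K0 | n K0]; simpl.
- destruct e as [|n|x r Q B]; try discriminate.
  + intros [= <-]. reflexivity.
  + rewrite nth_error_map. destruct (nth_error rho x); try discriminate.
    intros [= <-]. simpl. rewrite map_esub_closures. reflexivity.
- destruct a as [w|[us e] rho|f]; try discriminate; intros [= <-]; simpl; auto.
  rewrite map_app. reflexivity.
- destruct K0 as [|[B rho] K0]; try discriminate. intros [= <-]. reflexivity.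
Qed.

Lemma steps_inst th K n s s' : steps n s s' -> steps n (inst th K s) (inst th K s').
Proof. induction 1; econstructor; eauto using step_inst. Qed.

Lemma stuck_inst th K s : is_stuck s -> is_stuck (inst th K s).
Proof.
intros [Hs Hval]. split; destruct s as [e rho K0 | a bs K0 | n K0]; simpl in *; auto.
- destruct e as [|n|x r Q B]; try discriminate; auto.
  rewrite nth_error_map. destruct (nth_error rho x); [discriminate | reflexivity].
- destruct a as [w|[us e] rho|f]; try discriminate. tauto.
- destruct K0 as [|[B rho] K0]; [tauto | discriminate].
- destruct a as [w|[us e] rho|f]; try discriminate. tauto.
- destruct K0 as [|[B rho] K0]; [tauto | discriminate].
Qed.

Lemma inst_converges [th K s v] : converges (inst th K s) v -> exists w, converges s w.
Proof.
intros (n & Hn & Hval). revert s Hn. induction n as [|n IH]; intros s Hn;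
  (destruct (state_cases s) as [Hs | [Hs | [s' Hs]]];
    [exists s; apply converges_value, Hs
    | destruct (stuck_diverges _ v (stuck_inst th K s Hs)); eexists; split; eassumption |]);
  inversion Hn as [s0 E1 E2 | m s0 s1 s2 Hs1 Hm]; subst.
- apply (step_inst th K) in Hs.
  rewrite (value_no_step Hval) in Hs. discriminate.
- rewrite (step_inst th K _ _ Hs) in Hs1. injection Hs1 as <-.
  destruct (IH _ Hm) as [w Hw]. exists w. apply (converges_steps _ (steps_1 Hs)), Hw.
Qed.

(** * Code in a renaming environment *)

Lemma nf_Eval_ren G D f e : typed_e G e ->
  (forall v t, nth_error G v = Some t -> nth_error D (f v) = Some t) ->
  (forall i, f (length G + i) = length D + i) ->
  eeq (nf D (Eval e (map (fun v => Var (f v)) (seq 0 (length G))) [])) (ren_e f e).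
Proof.
revert G D e. cofix IH. intros G D e He Hf Hoff.
set (rho := map (fun v => Var (f v)) (seq 0 (length G))). rewrite ren_e_eq.
destruct He as [G | G n | G x ts Q B Hx HQ HB].
- rewrite nf_Eval_Bot. constructor.
- rewrite nf_Eval_Num. constructor.
- rewrite (nf_step _ _ (Call (Var (f x)) (closures (length ts) Q rho) [(B, rho)])).
  2:{ simpl. unfold rho. rewrite nth_error_map, nth_error_seq.
      rewrite (proj2 (Nat.ltb_lt _ _) (nth_error_lt Hx)). reflexivity. }
  rewrite (nf_Call_Var (Hf _ _ Hx)). constructor.
  + intros i Hi. specialize (HQ i _ (nth_error_nth' ts N Hi)). rewrite nth_closures by exact Hi.
    destruct HQ as [G us b Hb]. rewrite nf_entry_eq, ren_p_eq. constructor.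
    rewrite (nf_step _ _ (Eval b (rho ++ fresh D us) [])) by reflexivity.
    replace (rho ++ _) with (map (fun v => Var (f v)) (seq 0 (length (G ++ us)))).
    * apply IH; [exact Hb | |].
      -- intros v u Hv. rewrite nth_error_app in Hv. destruct (Nat.ltb_spec v (length G)) as [H|H].
         ++ apply nth_error_prefix, Hf, Hv.
         ++ replace v with (length G + (v - length G)) by lia.
            rewrite Hoff, nth_error_app_add. exact Hv.
      -- intros j. rewrite !length_app, <- !Nat.add_assoc. apply Hoff.
    * rewrite length_app, seq_app, map_app. unfold rho. f_equal. unfold vars.
      rewrite map_seq_shift, (map_seq_shift Var). apply map_ext. intros j. f_equal. apply Hoff.
  + intros i. rewrite (nf_step _ _ (Eval (B i) rho [])) by reflexivity. apply IH; auto.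
Qed.

Lemma nf_Eval_id D e : typed_e D e -> eeq (nf D (Eval e (id_env D) [])) e.
Proof.
intros He. transitivity (ren_e (fun v => v) e); [|apply ren_e_id; reflexivity].
apply (nf_Eval_ren D D (fun v => v)); auto.
Qed.

Lemma nf_entry_Clo_id D p t : typed_p D p t -> peq (nf_entry D t (Clo p (id_env D))) p.
Proof.
intros Hp. destruct Hp as [D us e He]. rewrite nf_entry_eq. constructor.
rewrite (nf_step _ _ (Eval e (id_env D ++ fresh D us) [])) by reflexivity.
rewrite (vars_app 0), <- length_app. apply nf_Eval_id. exact He.
Qed.

Lemma nf_Eval_id_stack D e K : typed_e D e ->
  eeq (nf D (Eval e (id_env D) K)) (repl_e (fun i => nf D (Ret i K)) e).
Proof.
revert D e. cofix IH. intros D e He. rewrite repl_e_eq.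
destruct He as [D | D n | D x ts Q B Hx HQ HB].
- rewrite nf_Eval_Bot. constructor.
- rewrite (nf_step _ _ (Ret n K)) by reflexivity. apply eeq_refl.
- erewrite nf_step by (simpl; rewrite nth_error_vars by exact (nth_error_lt Hx); reflexivity).
  rewrite (nf_Call_Var Hx). constructor.
  + intros i Hi. rewrite nth_closures by exact Hi. apply nf_entry_Clo_id, HQ, nth_error_nth', Hi.
  + intros i. erewrite nf_step by reflexivity. apply IH, HB.
Qed.

(** * Normal forms are faithful code *)

(* The right-hand side of the simulation is obtained from the left-hand side by replacing code that
   is a normal form by what it is the normal form of; [sim_Clo], [sim_stack_cons] and [sim_Eval]
   do this for closures, frames and states. *)
Inductive sim_entry (D : list ty) : ty -> entry -> entry -> Prop :=
| sim_Var : forall w t, nth_error D w = Some t -> sim_entry D t (Var w) (Var w)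
| sim_Rec : forall ss f f',
    sim_entry D (Arr (Arr ss :: ss)) f f' -> sim_entry D (Arr ss) (Rec f) (Rec f')
| sim_Clo : forall D0 t p a rho rho',
    typed_entry D0 t a -> peq p (nf_entry D0 t a) -> sim_env D D0 rho rho' ->
    sim_entry D t (Clo p rho) (esub (assign rho' 0) a)
with sim_env (D : list ty) : list ty -> list entry -> list entry -> Prop :=
| sim_nil : sim_env D [] [] []
| sim_cons : forall t G a b rho rho',
    sim_entry D t a b -> sim_env D G rho rho' -> sim_env D (t :: G) (a :: rho) (b :: rho').

Scheme sim_entry_mut := Induction for sim_entry Sort Prop
with sim_env_mut := Induction for sim_env Sort Prop.
Combined Scheme sim_entry_env_ind from sim_entry_mut, sim_env_mut.

Inductive sim_stack (D : list ty) : list frame -> list frame -> Prop :=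
| sim_stack_nil : sim_stack D [] []
| sim_stack_cons : forall D0 B rho rho' K0 K K',
    typed_stack D0 K0 -> (forall i, eeq (B i) (nf D0 (Ret i K0))) -> sim_env D D0 rho rho' ->
    sim_stack D K K' ->
    sim_stack D ((B, rho) :: K) (map (fsub (assign rho' 0)) K0 ++ K').

Inductive sim_state (D : list ty) : state -> state -> Prop :=
| sim_Eval : forall D0 e rho rho' s K K',
    typed_state D0 s -> eeq e (nf D0 s) -> sim_env D D0 rho rho' -> sim_stack D K K' ->
    sim_state D (Eval e rho K) (inst (assign rho' 0) K' s)
| sim_Call : forall ts a b bs bs' K K',
    sim_entry D (Arr ts) a b -> sim_env D ts bs bs' -> sim_stack D K K' ->
    sim_state D (Call a bs K) (Call b bs' K')
| sim_Ret : forall n K K', sim_stack D K K' -> sim_state D (Ret n K) (Ret n K').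

Inductive sim_value (D : list ty) : state -> state -> Prop :=
| sim_value_Call : forall w ts bs bs' K K',
    nth_error D w = Some (Arr ts) -> sim_env D ts bs bs' -> sim_stack D K K' ->
    sim_value D (Call (Var w) bs K) (Call (Var w) bs' K')
| sim_value_Ret : forall n, sim_value D (Ret n []) (Ret n []).

Inductive sim_progress (D : list ty) (s s' : state) : Prop :=
| progress_diverge :
    (forall v, ~ converges s v) -> (forall v, ~ converges s' v) -> sim_progress D s s'
| progress_value : forall i j v v',
    steps i s v -> steps j s' v' -> sim_value D v v' -> sim_progress D s s'
| progress_steps : forall i j s1 s1',
    steps (S i) s s1 -> steps (S j) s' s1' -> sim_state D s1 s1' -> sim_progress D s s'.

Lemma sim_env_length [D G rho rho'] : sim_env D G rho rho' ->
  length rho = length G /\ length rho' = length G.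
Proof. induction 1; simpl; intuition congruence. Qed.

Lemma sim_env_app [D G G' rho rho' bs bs'] : sim_env D G rho rho' -> sim_env D G' bs bs' ->
  sim_env D (G ++ G') (rho ++ bs) (rho' ++ bs').
Proof. induction 1; simpl; auto. intros. constructor; auto. Qed.

Lemma sim_env_nth_error [D G rho rho' x t] : sim_env D G rho rho' -> nth_error G x = Some t ->
  exists a b, nth_error rho x = Some a /\ nth_error rho' x = Some b /\ sim_entry D t a b.
Proof.
intros H. revert x. induction H as [|u G a b rho rho' Hab _ IH]; intros [|x] Hx; try discriminate.
- injection Hx as <-. exists a, b. auto.
- exact (IH x Hx).
Qed.

Lemma sim_weaken D D' :
  (forall t a b, sim_entry D t a b -> sim_entry (D ++ D') t a b) /\
  (forall G rho rho', sim_env D G rho rho' -> sim_env (D ++ D') G rho rho').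
Proof.
apply sim_entry_env_ind; intros; try (econstructor; eassumption).
constructor. apply nth_error_prefix. assumption.
Qed.

Lemma sim_env_Forall2 D G rho : Forall2 (fun t a => sim_entry D t a a) G rho -> sim_env D G rho rho.
Proof. induction 1; constructor; auto. Qed.

Lemma sim_entry_refl D t a : typed_entry D t a -> sim_entry D t a a.
Proof.
revert t a. apply typed_entry_ind_nested.
- intros w t Hw. constructor. exact Hw.
- intros G t p rho Hp Hrho IH.
  assert (E : Clo p rho = esub (assign rho 0) (Clo p (id_env G))).
  { simpl. rewrite (Forall2_length Hrho), map_assign_vars. reflexivity. }
  rewrite E at 2. apply (sim_Clo D G).
  + econstructor; [exact Hp | apply typed_id_env].
  + symmetry. apply nf_entry_Clo_id, Hp.
  + apply sim_env_Forall2, IH.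
- intros ss f IH. constructor. exact IH.
Qed.

Lemma sim_env_refl [D G rho] : typed_env D G rho -> sim_env D G rho rho.
Proof.
intros H. apply sim_env_Forall2. eapply Forall2_impl; [|exact H]. apply sim_entry_refl.
Qed.

Lemma sim_stack_refl D K : typed_stack D K -> sim_stack D K K.
Proof.
induction 1 as [|[B rho] K (G & Hrho & HB) HK IH]; [constructor|]. simpl in *.
assert (E : (B, rho) :: K = map (fsub (assign rho 0)) [(B, id_env G)] ++ K).
{ simpl. unfold fsub. simpl. rewrite (Forall2_length Hrho), map_assign_vars. reflexivity. }
rewrite E at 2. apply (sim_stack_cons D G); [| | apply sim_env_refl, Hrho | exact IH].
- constructor; [|constructor]. exists G. split; [apply typed_id_env | exact HB].
- intros i. erewrite nf_step by reflexivity. symmetry. apply nf_Eval_id, HB.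
Qed.

Lemma sim_closures D D0 rho rho' ts bs Q : sim_env D D0 rho rho' -> typed_env D0 ts bs ->
  (forall i, i < length ts -> peq (Q i) (nf_entry D0 (nth i ts N) (nth i bs (Var 0)))) ->
  sim_env D ts (closures (length ts) Q rho) (map (esub (assign rho' 0)) bs).
Proof.
intros Hrho Hbs. revert Q. induction Hbs as [|t b ts bs Hb _ IH]; intros Q HQ; [constructor|].
simpl length. rewrite closures_S. constructor.
- apply (sim_Clo D D0); [exact Hb | apply (HQ 0); simpl; lia | exact Hrho].
- apply IH. intros i Hi. apply (HQ (S i)). simpl. lia.
Qed.

Lemma sim_progress_steps [D i j s s1 s' s1'] : steps i s s1 -> steps j s' s1' ->
  sim_progress D s1 s1' -> sim_progress D s s'.
Proof.
intros Hs Hs' [Hd Hd' | k l v v' Hv Hv' Hsim | k l s2 s2' H2 H2' Hsim].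
- apply progress_diverge; intros v; [rewrite (converges_steps v Hs)
    | rewrite (converges_steps v Hs')]; auto.
- exact (progress_value D s s' _ _ v v' (steps_trans Hs Hv)
    (steps_trans Hs' Hv') Hsim).
- apply (progress_steps D s s' (i + k) (j + l) s2 s2'); [| |exact Hsim];
    rewrite <- Nat.add_succ_r; eapply steps_trans; eassumption.
Qed.

Lemma sim_progress_Ret [D K K'] : sim_stack D K K' -> forall n, sim_progress D (Ret n K) (Ret n K').
Proof.
induction 1 as [|D0 B rho rho' K0 K K' HK0 HB Hrho HK IH]; intros n.
- apply (progress_value D _ _ 0 0 (Ret n []) (Ret n [])); constructor.
- destruct HK0 as [|[B0 rho0] K0 (G & Hrho0 & HB0) HK0].
  + eapply sim_progress_steps; [| apply steps_0 | apply IH].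
    specialize (HB n). rewrite nf_Ret_nil in HB. inversion HB as [|k E Ek|]. subst k.
    econstructor; [reflexivity|]. apply steps_1. rewrite <- E. reflexivity.
  + apply (progress_steps D _ _ 0 0 (Eval (B n) rho K)
      (inst (assign rho' 0) K' (Eval (B0 n) rho0 K0))); try (apply steps_1; reflexivity).
    apply (sim_Eval D D0); auto.
    * econstructor; [apply HB0 | exact Hrho0 | exact HK0].
    * rewrite HB. erewrite nf_step by reflexivity. reflexivity.
Qed.

Lemma sim_step_nf_Call_Var [D D0 e rho rho' w us bs K0 K K'] :
  typed_state D0 (Call (Var w) bs K0) -> nth_error D0 w = Some (Arr us) ->
  eeq e (nf D0 (Call (Var w) bs K0)) -> sim_env D D0 rho rho' -> sim_stack D K K' ->
  exists a b cs K1, nth_error rho w = Some a /\ nth_error rho' w = Some b /\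
    step (Eval e rho K) = Some (Call a cs K1) /\ sim_entry D (Arr us) a b /\
    sim_env D us cs (map (esub (assign rho' 0)) bs) /\
    sim_stack D K1 (map (fsub (assign rho' 0)) K0 ++ K').
Proof.
intros Hs Hw He Hrho HK. inversion Hs as [|ts a0 bs0 K2 Ha Hbs HK0|]; subst.
apply typed_Var_inv in Ha. rewrite Hw in Ha. injection Ha as <-.
rewrite (nf_Call_Var Hw) in He. inversion He as [| |x r Q Q' B B' HQ HB]; subst.
destruct (sim_env_nth_error Hrho Hw) as (a & b & Ha & Hb & Hab).
exists a, b, (closures (length us) Q rho), ((B, rho) :: K).
simpl. rewrite Ha. repeat split; auto.
- exact (sim_closures D D0 rho rho' us bs Q Hrho Hbs HQ).
- apply (sim_stack_cons D D0); auto.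
Qed.

Lemma inst_Call_vars D ts a rho bs K : typed_entry D (Arr ts) a ->
  length rho = length D -> length bs = length ts ->
  inst (assign (rho ++ bs) 0) K (Call a (fresh D ts) []) =
  Call (esub (assign rho 0) a) bs K.
Proof.
intros Ha Hl <-. simpl. rewrite <- Hl, (proj2 (map_assign_vars_app rho bs 0)). f_equal.
symmetry. apply (esub_ext Ha). intros w Hw. rewrite <- Hl in Hw. unfold assign.
rewrite app_nth1 by exact Hw. apply nth_indep, Hw.
Qed.

Lemma sim_step_Call_Clo [D D0 ts p a rho rho' bs bs'] K K'
  (s := Call a (fresh D0 ts) []) :
  typed_entry D0 (Arr ts) a -> peq p (nf_entry D0 (Arr ts) a) ->
  sim_env D D0 rho rho' -> sim_env D ts bs bs' ->
  exists e, step (Call (Clo p rho) bs K) = Some (Eval e (rho ++ bs) K) /\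
    eeq e (nf (D0 ++ ts) s) /\ typed_state (D0 ++ ts) s /\
    inst (assign (rho' ++ bs') 0) K' s = Call (esub (assign rho' 0) a) bs' K'.
Proof.
intros Ha Hp Hrho Hbs. rewrite nf_entry_eq in Hp.
apply peq_sym, peq_inv in Hp. destruct Hp as (e & -> & He). exists e.
split; [reflexivity|]. split; [exact (eeq_sym _ _ He)|]. split.
- econstructor; [exact (typed_entry_weaken Ha) | apply typed_fresh | constructor].
- apply inst_Call_vars; [exact Ha | apply (sim_env_length Hrho)
    | apply (sim_env_length Hbs)].
Qed.

Lemma sim_progress_Call [D ts a b bs bs' K K'] : sim_entry D (Arr ts) a b ->
  sim_env D ts bs bs' -> sim_stack D K K' -> sim_progress D (Call a bs K) (Call b bs' K').
Proof.
intros Hab. remember (Arr ts) as t eqn:Et. revert ts Et bs bs' K K'.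
induction Hab as [w t Hw | ss f f' Hf _ | D0 t p a rho rho' Ha Hp Hrho IHrho | |]
  using sim_entry_mut
  with (P0 := fun G rho rho' _ => forall x ts a b, nth_error G x = Some (Arr ts) ->
    nth_error rho x = Some a -> nth_error rho' x = Some b -> forall bs bs' K K',
    sim_env D ts bs bs' -> sim_stack D K K' -> sim_progress D (Call a bs K) (Call b bs' K')).
- intros ts -> bs bs' K K' Hbs HK.
  apply (progress_value D _ _ 0 0 (Call (Var w) bs K) (Call (Var w) bs' K')); try constructor.
  econstructor; eassumption.
- intros ts [= <-] bs bs' K K' Hbs HK.
  apply (progress_steps D _ _ 0 0 (Call f (Rec f :: bs) K) (Call f' (Rec f' :: bs') K'));
    try (apply steps_1; reflexivity).
  econstructor; [exact Hf | | exact HK]. constructor; [constructor; exact Hf | exact Hbs].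
- intros ts -> bs bs' K K' Hbs HK.
  destruct (sim_step_Call_Clo K K' Ha Hp Hrho Hbs) as (e & Hstep & He & Hs & Einst).
  pose proof (sim_env_app Hrho Hbs) as Henv.
  destruct (state_cases (Call a (fresh D0 ts) []))
    as [Hval | [[Hstuck Hnval] | [s Hs1]]].
  + destruct a as [w| |]; try contradiction. apply typed_Var_inv in Ha.
    destruct (sim_env_nth_error Hrho Ha) as (a & b & Hwa & Hwb & _).
    destruct (sim_step_nf_Call_Var Hs (nth_error_prefix Ha) He
      Henv HK) as (a' & b' & cs & K1 & Hwa' & _ & Hstep' & _ & Hcs & HK1).
    rewrite (nth_error_prefix Hwa) in Hwa'. injection Hwa' as <-.
    injection Einst as _ Ebs. rewrite Ebs in Hcs. simpl. rewrite (assign_nth_error Hwb).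
    eapply sim_progress_steps.
    * econstructor; [exact Hstep | exact (steps_1 Hstep')].
    * apply steps_0.
    * exact (IHrho w ts a b Ha Hwa Hwb _ _ _ _ Hcs HK1).
  + destruct a as [| [] |]; discriminate || destruct (Hnval I).
  + rewrite <- Einst. apply (progress_steps D _ _ 0 0 (Eval e (rho ++ bs) K)
      (inst (assign (rho' ++ bs') 0) K' s));
      [apply steps_1, Hstep | apply steps_1, step_inst, Hs1 |].
    apply (sim_Eval D (D0 ++ ts)); [eapply typed_step; eassumption | | exact Henv | exact HK].
    rewrite He, (nf_step _ _ _ Hs1). reflexivity.
- intros [|x] ts a b Hx; discriminate.
- intros [|x] ts a' b' Hx Ha Hb; simpl in *; [|eauto].
  injection Hx as ->. injection Ha as <-. injection Hb as <-. eauto.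
Qed.

Lemma sim_progress_Eval [D D0 e rho rho' s K K'] :
  typed_state D0 s -> eeq e (nf D0 s) -> sim_env D D0 rho rho' -> sim_stack D K K' ->
  sim_progress D (Eval e rho K) (inst (assign rho' 0) K' s).
Proof.
intros Hs He Hrho HK. destruct (converges_or_diverges s) as [[v [n [Hn Hval]]] | Hdiv].
- rewrite (nf_steps Hn) in He. apply (typed_steps Hn) in Hs.
  apply (steps_inst (assign rho' 0) K') in Hn.
  destruct v as [ | [w| |] bs K0 | k [|]]; try contradiction.
  + inversion Hs as [|ts a bs0 K1 Hw Hbs HK0|]; subst. apply typed_Var_inv in Hw.
    destruct (sim_step_nf_Call_Var Hs Hw He Hrho HK)
      as (a & b & cs & K1 & _ & Hb & Hst & Hab & Hcs & HK1).
    apply (sim_progress_steps (steps_1 Hst) Hn).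
    simpl. rewrite (assign_nth_error Hb).
    exact (sim_progress_Call Hab Hcs HK1).
  + rewrite nf_Ret_nil in He. inversion He; subst.
    eapply sim_progress_steps;
      [apply steps_1; reflexivity | exact Hn | exact (sim_progress_Ret HK k)].
- rewrite nf_diverges in He by exact Hdiv. inversion He; subst. apply progress_diverge; intros v Hv.
  + exact (stuck_diverges (Eval Bot rho K) v (conj eq_refl (fun H => H)) Hv).
  + destruct (inst_converges Hv) as [w Hw]. exact (Hdiv w Hw).
Qed.

Lemma sim_state_progress [D s s'] : sim_state D s s' -> sim_progress D s s'.
Proof.
destruct 1 as [D0 e rho rho' s K K' Hs He Hrho HK | ts a b bs bs' K K' Hab Hbs HK | n K K' HK].
- exact (sim_progress_Eval Hs He Hrho HK).
- exact (sim_progress_Call Hab Hbs HK).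
- exact (sim_progress_Ret HK n).
Qed.

Lemma sim_value_is_value [D v v'] : sim_value D v v' -> is_value v /\ is_value v'.
Proof. destruct 1; simpl; auto. Qed.

Lemma sim_converges_l [D s s' v] : sim_state D s s' -> converges s v ->
  exists v', converges s' v' /\ sim_value D v v'.
Proof.
intros Hs [n Hv]. revert s s' Hs Hv. induction n as [n IH] using lt_wf_ind. intros s s' Hs Hv.
destruct (sim_state_progress Hs) as [Hdiv _ | i j w w' Hw Hw' Hsim | i j s1 s1' Hi Hj Hs1].
- destruct (Hdiv v). exists n. exact Hv.
- destruct (sim_value_is_value Hsim) as [Hval Hval'].
  rewrite (converges_unique (ex_intro _ n Hv) (ex_intro _ i (conj Hw Hval))).
  exists w'. split; [exists j; split; assumption | exact Hsim].
- destruct (evaluates_steps Hi Hv) as (m & -> & Hm).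
  destruct (IH m ltac:(lia) _ _ Hs1 Hm) as (v' & Hv' & Hsim).
  exists v'. split; [apply (converges_steps _ Hj), Hv' | exact Hsim].
Qed.

Lemma sim_converges_r [D s s' v'] : sim_state D s s' -> converges s' v' ->
  exists v, converges s v.
Proof.
intros Hs [n Hv]. revert s s' Hs Hv. induction n as [n IH] using lt_wf_ind. intros s s' Hs Hv.
destruct (sim_state_progress Hs) as [_ Hdiv | i j w w' Hw Hw' Hsim | i j s1 s1' Hi Hj Hs1].
- destruct (Hdiv v'). exists n. exact Hv.
- exists w, i. split; [exact Hw | apply (sim_value_is_value Hsim)].
- destruct (evaluates_steps Hj Hv) as (m & -> & Hm).
  destruct (IH m ltac:(lia) _ _ Hs1 Hm) as (v & Hc). exists v.
  apply (converges_steps _ Hi), Hc.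
Qed.

Lemma sim_nf D s s' : sim_state D s s' -> eeq (nf D s) (nf D s')
with sim_nf_entry D t a b : sim_entry D t a b -> peq (nf_entry D t a) (nf_entry D t b).
Proof.
- intros Hs. destruct (converges_or_diverges s) as [[v Hv] | Hdiv].
  + destruct (sim_converges_l Hs Hv) as (v' & Hv' & Hsim).
    rewrite (nf_converges Hv), (nf_converges Hv').
    destruct Hsim as [w ts bs bs' K K' Hw Hbs HK | n]; [|rewrite nf_Ret_nil; constructor].
    rewrite !(nf_Call_Var Hw). constructor.
    * intros i Hi. destruct (nth_error_exists ts i Hi) as [t Ht].
      destruct (sim_env_nth_error Hbs Ht) as (a & b & Ha & Hb & Hab).
      rewrite (nth_error_nth _ _ _ Ht), (nth_error_nth _ _ _ Ha), (nth_error_nth _ _ _ Hb).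
      apply sim_nf_entry, Hab.
    * intros i. apply sim_nf. constructor. exact HK.
  + rewrite (nf_diverges D s Hdiv), (nf_diverges D s'); [constructor|].
    intros v' Hv'. destruct (sim_converges_r Hs Hv') as [v Hv]. exact (Hdiv v Hv).
- intros Hab. destruct t as [us]. rewrite !nf_entry_eq. constructor. apply sim_nf.
  apply (sim_Call _ us); [apply sim_weaken, Hab | apply sim_env_refl, typed_fresh | constructor].
Qed.

Lemma nf_Eval_nf D D0 e s rho K : typed_state D0 s -> eeq e (nf D0 s) -> typed_env D D0 rho ->
  typed_stack D K -> eeq (nf D (Eval e rho K)) (nf D (inst (assign rho 0) K s)).
Proof.
intros Hs He Hrho HK. apply sim_nf, (sim_Eval D D0); auto using sim_env_refl, sim_stack_refl.
Qed.

Lemma nf_Call_nf D D0 p a ts rho bs :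
  typed_entry D0 (Arr ts) a -> peq p (nf_entry D0 (Arr ts) a) ->
  typed_env D D0 rho -> typed_env D ts bs ->
  eeq (nf D (Call (Clo p rho) bs [])) (nf D (Call (esub (assign rho 0) a) bs [])).
Proof.
intros Ha Hp Hrho Hbs. apply sim_nf, (sim_Call D ts); [|apply sim_env_refl, Hbs | constructor].
apply (sim_Clo D D0); auto using sim_env_refl.
Qed.

Lemma nf_Call_stack D ts a bs K : typed_entry D (Arr ts) a -> typed_env D ts bs ->
  typed_stack D K ->
  eeq (nf D (Call a bs K)) (repl_e (fun i => nf D (Ret i K)) (nf D (Call a bs []))).
Proof.
intros Ha Hbs HK. assert (Hs : typed_state D (Call a bs [])) by (econstructor; eauto; constructor).
rewrite <- (nf_Eval_id_stack D _ K (typed_nf D _ Hs)).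
change (Call a bs K) with (Call a bs ([] ++ K)). rewrite <- (inst_id D (Call a bs []) K Hs).
symmetry. apply (nf_Eval_nf D D); auto using typed_id_env. reflexivity.
Qed.

Lemma nf_weaken G Z s : typed_state G s ->
  eeq (nf (G ++ Z) s) (ren_e (shift (length G) (length Z)) (nf G s)).
Proof.
intros Hs. pose proof (typed_nf G s Hs) as He.
rewrite <- (nf_Eval_ren G (G ++ Z) _ _ He).
- rewrite (map_ext_in _ Var).
  + transitivity (nf (G ++ Z) (inst (assign (id_env G) 0) [] s)).
    * rewrite (inst_id G s [] Hs). destruct s; rewrite app_nil_r; reflexivity.
    * symmetry. apply (nf_Eval_nf (G ++ Z) G); [exact Hs | reflexivity | | constructor].
      apply typed_env_weaken, typed_id_env.
  + intros v Hv. apply in_seq in Hv. rewrite shift_lt by lia. reflexivity.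
- intros v t Hv. rewrite shift_lt by exact (nth_error_lt Hv). apply nth_error_prefix, Hv.
- intros i. rewrite shift_ge, length_app by lia. lia.
Qed.

Lemma nf_strengthen G Z s : typed_state G s ->
  eeq (ren_e (fun v => if v <? length G then v else v - (length G + length Z) + length G)
         (nf (G ++ Z) s)) (nf G s).
Proof.
intros Hs. rewrite (ren_e_eeq _ _ _ (nf_weaken G Z s Hs)). apply ren_e_cancel.
intros v. unfold shift. destruct (Nat.ltb_spec v (length G)) as [H|H].
- apply Nat.ltb_lt in H. rewrite H. reflexivity.
- rewrite (proj2 (Nat.ltb_ge _ _)) by lia. lia.
Qed.

Lemma eta_nf_entry G x t : nth_error G x = Some t ->
  peq (eta (length G) x t) (nf_entry G t (Var x)).
Proof.
revert G x t. cofix IH. intros G x [ts] Hx. rewrite eta_eq, nf_entry_eq.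
rewrite (nf_Call_Var (nth_error_prefix Hx)). constructor. constructor.
- intros i Hi. rewrite nth_vars, <- length_app by exact Hi. apply IH.
  rewrite nth_error_app_add. apply nth_error_nth', Hi.
- intros i. rewrite nf_Ret_nil. constructor.
Qed.

Lemma Fy_nf_entry G x ss : nth_error G x = Some (Arr (Arr ss :: ss)) ->
  peq (Fy (length G) x ss) (nf_entry G (Arr ss) (Rec (Var x))).
Proof.
revert G x ss. cofix IH. intros G x ss Hx. rewrite Fy_eq, nf_entry_eq.
erewrite nf_step by reflexivity.
rewrite (nf_Call_Var (nth_error_prefix Hx)).
constructor. constructor.
- intros [|i] Hi; simpl; rewrite <- length_app.
  + apply IH, nth_error_prefix, Hx.
  + apply Nat.succ_lt_mono in Hi. rewrite nth_vars by exact Hi.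
    apply eta_nf_entry. rewrite nth_error_app_add. apply nth_error_nth', Hi.
- intros i. rewrite nf_Ret_nil. constructor.
Qed.

(** * Meta-terms as closures *)

Lemma mexpr_eta E : E = match E with MBot => MBot | MNum n => MNum n | MCase G B => MCase G B end.
Proof. destruct E; reflexivity. Qed.

Lemma mground_eta G :
  G = match G with GE E => GE E | GVar x r Q => GVar x r Q | GApp P r Q => GApp P r Q end.
Proof. destruct G; reflexivity. Qed.

Lemma mproc_eta P : P = match P with MLam ts E => MLam ts E end.
Proof. destruct P; reflexivity. Qed.

Lemma embed_e_eq e : embed_e e =
  match e with
  | Bot => MBot
  | Num n => MNum n
  | Case x r Q B => MCase (GVar x r (fun i => embed_p (Q i))) (fun i => embed_e (B i))
  end.
Proof. rewrite (mexpr_eta (embed_e e)). destruct e; reflexivity. Qed.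

Lemma embed_p_eq ts e : embed_p (Lam ts e) = MLam ts (embed_e e).
Proof. rewrite (mproc_eta (embed_p (Lam ts e))). reflexivity. Qed.

Lemma mren_e_eq f E : mren_e f E =
  match E with
  | MBot => MBot
  | MNum n => MNum n
  | MCase G B => MCase (mren_g f G) (fun i => mren_e f (B i))
  end.
Proof. rewrite (mexpr_eta (mren_e f E)). destruct E; reflexivity. Qed.

Lemma mren_g_eq f G : mren_g f G =
  match G with
  | GE E => GE (mren_e f E)
  | GVar x r Q => GVar (f x) r (fun i => mren_p f (Q i))
  | GApp P r Q => GApp (mren_p f P) r (fun i => mren_p f (Q i))
  end.
Proof. rewrite (mground_eta (mren_g f G)). destruct G; reflexivity. Qed.

Lemma mren_p_eq f ts E : mren_p f (MLam ts E) = MLam ts (mren_e f E).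
Proof. rewrite (mproc_eta (mren_p f (MLam ts E))). reflexivity. Qed.

Lemma sub_e_eq n0 n1 s d E : sub_e n0 n1 s d E =
  match E with
  | MBot => MBot
  | MNum n => MNum n
  | MCase G B => MCase (sub_g n0 n1 s d G) (fun i => sub_e n0 n1 s d (B i))
  end.
Proof. rewrite (mexpr_eta (sub_e n0 n1 s d E)). destruct E; reflexivity. Qed.

Lemma sub_g_eq n0 n1 s d G : sub_g n0 n1 s d G =
  match G with
  | GE E => GE (sub_e n0 n1 s d E)
  | GVar v r Q =>
      if v <? n0 then
        match s v with
        | SVar w => GVar w r (fun i => sub_p n0 n1 s d (Q i))
        | STm P => GApp (mren_p (shift n1 (d - n0)) P) r (fun i => sub_p n0 n1 s d (Q i))
        end
      else GVar (v - n0 + n1) r (fun i => sub_p n0 n1 s d (Q i))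
  | GApp P r Q => GApp (sub_p n0 n1 s d P) r (fun i => sub_p n0 n1 s d (Q i))
  end.
Proof.
rewrite (mground_eta (sub_g n0 n1 s d G)). destruct G; simpl; try reflexivity.
destruct (_ <? _); [destruct (s _)|]; reflexivity.
Qed.

Lemma sub_p_eq n0 n1 s d ts E :
  sub_p n0 n1 s d (MLam ts E) = MLam ts (sub_e n0 n1 s (d + length ts) E).
Proof. rewrite (mproc_eta (sub_p n0 n1 s d (MLam ts E))). reflexivity. Qed.

(* [enters a bs ts e rho]: calling [a] with the arguments [bs], of types [ts], runs [e] in [rho]. *)
Inductive enters : entry -> list entry -> list ty -> expr -> list entry -> Prop :=
| enters_Clo : forall ts e rho bs, enters (Clo (Lam ts e) rho) bs ts e (rho ++ bs)
| enters_Rec : forall t ts e rho bs,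
    enters (Rec (Clo (Lam (t :: ts) e) rho)) bs ts e (rho ++ Rec (Clo (Lam (t :: ts) e) rho) :: bs).

Lemma enters_esub th a bs ts e rho : enters a bs ts e rho ->
  enters (esub th a) (map (esub th) bs) ts e (map (esub th) rho).
Proof. destruct 1; simpl; rewrite map_app; constructor. Qed.

Lemma enters_typed [a bs ts e rho D us] : enters a bs ts e rho ->
  typed_entry D (Arr us) a -> ts = us.
Proof.
intros [ts' e' rho' bs' | t ts' e' rho' bs'] Ha;
  [inversion Ha as [|G t' p th Hp|]
  |inversion Ha as [| |ss f Hf]; inversion Hf as [|G t' p th Hp|]];
  inversion Hp; congruence.
Qed.

Lemma enters_steps [a bs ts e rho] K : enters a bs ts e rho ->
  exists j, steps (S j) (Call a bs K) (Eval e rho K).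
Proof.
destruct 1; [exists 0 | exists 1; econstructor; [reflexivity|]]; apply steps_1; reflexivity.
Qed.

(* [unfolds_e d E e rho]: the meta-expression [E], in an environment of length [d], is the code [e]
   with the entries of [rho] substituted for its variables; [GE] does not occur in [E]. *)
CoInductive unfolds_e : nat -> mexpr -> expr -> list entry -> Prop :=
| unfolds_Bot : forall d rho, unfolds_e d MBot Bot rho
| unfolds_Num : forall d n rho, unfolds_e d (MNum n) (Num n) rho
| unfolds_Case : forall d T B x r Q B' rho,
    unfolds_g d T x r Q rho -> (forall i, unfolds_e d (B i) (B' i) rho) ->
    unfolds_e d (MCase T B) (Case x r Q B') rho
with unfolds_g : nat -> mground -> nat -> nat -> (nat -> proc) -> list entry -> Prop :=
| unfolds_GVar : forall d w x r Q Q' rho,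
    nth_error rho x = Some (Var w) -> (forall i, i < r -> unfolds_p d (Q i) (Clo (Q' i) rho)) ->
    unfolds_g d (GVar w r Q) x r Q' rho
| unfolds_GApp : forall d P a x r Q Q' rho,
    nth_error rho x = Some a -> unfolds_p d P a ->
    (forall i, i < r -> unfolds_p d (Q i) (Clo (Q' i) rho)) ->
    unfolds_g d (GApp P r Q) x r Q' rho
with unfolds_p : nat -> mproc -> entry -> Prop :=
| unfolds_MLam : forall d ts A a e rho,
    enters a (vars d (length ts)) ts e rho -> unfolds_e (d + length ts) A e rho ->
    unfolds_p d (MLam ts A) a.

Lemma unfolds_e_embed G e : typed_e G e -> unfolds_e (length G) (embed_e e) e (id_env G)
with unfolds_p_embed G p t : typed_p G p t ->
  unfolds_p (length G) (embed_p p) (Clo p (id_env G)).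
Proof.
- destruct 1 as [| |G x ts Q B Hx HQ HB]; rewrite embed_e_eq; constructor.
  + constructor.
    * apply (nth_error_vars 0). exact (nth_error_lt Hx).
    * intros i Hi. destruct (nth_error_exists ts i Hi) as [t Ht].
      eapply unfolds_p_embed. exact (HQ i t Ht).
  + intros i. apply unfolds_e_embed. apply HB.
- destruct 1 as [G ts e He]. rewrite embed_p_eq. econstructor; [constructor|].
  rewrite (vars_app 0), <- length_app. apply unfolds_e_embed. exact He.
Qed.

Definition shift_entry (n k : nat) : entry -> entry := esub (fun w => Var (shift n k w)).

Lemma map_shift_vars_ge n k d m : n <= d -> map (shift_entry n k) (vars d m) = vars (d + k) m.
Proof. intros H. apply map_esub_vars_shift. intros i. f_equal. rewrite shift_ge by lia. lia. Qed.

Lemma map_shift_vars_le n k m : m <= n -> map (shift_entry n k) (vars 0 m) = vars 0 m.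
Proof.
intros H. unfold shift_entry. rewrite map_esub_vars. apply map_ext_in. intros v Hv.
apply in_seq in Hv. rewrite shift_lt by lia. reflexivity.
Qed.

Lemma unfolds_e_mren n k d E e rho : n <= d -> unfolds_e d E e rho ->
  unfolds_e (d + k) (mren_e (shift n k) E) e (map (shift_entry n k) rho)
with unfolds_g_mren n k d T x r Q rho : n <= d -> unfolds_g d T x r Q rho ->
  unfolds_g (d + k) (mren_g (shift n k) T) x r Q (map (shift_entry n k) rho)
with unfolds_p_mren n k d P a : n <= d -> unfolds_p d P a ->
  unfolds_p (d + k) (mren_p (shift n k) P) (shift_entry n k a).
Proof.
- intros Hd. destruct 1 as [| |d T B x r Q B' rho HT HB]; rewrite mren_e_eq; constructor.
  + apply unfolds_g_mren; assumption.
  + intros i. apply unfolds_e_mren; [assumption | apply HB].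
- intros Hd. destruct 1 as [d w x r Q Q' rho Hx HQ | d P a x r Q Q' rho Hx HP HQ];
    rewrite mren_g_eq.
  + constructor; [rewrite nth_error_map, Hx; reflexivity|]. intros i Hi.
    apply (unfolds_p_mren n k d (Q i) (Clo (Q' i) rho)); [assumption | exact (HQ i Hi)].
  + econstructor; [rewrite nth_error_map, Hx; reflexivity| |].
    * apply unfolds_p_mren; assumption.
    * intros i Hi.
      apply (unfolds_p_mren n k d (Q i) (Clo (Q' i) rho)); [assumption | exact (HQ i Hi)].
- intros Hd. destruct 1 as [d ts A a e rho Ha HA]. rewrite mren_p_eq. econstructor.
  + rewrite <- (map_shift_vars_ge n) by assumption. apply enters_esub. exact Ha.
  + replace (d + k + length ts) with (d + length ts + k) by lia.
    apply unfolds_e_mren; [lia | exact HA].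
Qed.

Lemma unfolds_p_weaken D t P a k : typed_entry D t a -> unfolds_p (length D) P a ->
  unfolds_p (length D + k) (mren_p (shift (length D) k) P) a.
Proof.
intros Ha HP. apply (unfolds_p_mren (length D) k) in HP; [|apply Nat.le_refl].
unfold shift_entry in HP. rewrite (esub_id Ha) in HP; [exact HP|].
intros w Hw. rewrite shift_lt by exact Hw. reflexivity.
Qed.

Definition substitutes (n : nat) (s : nat -> sval) (th : list entry) : Prop :=
  forall v a, nth_error th v = Some a ->
  match s v with
  | SVar w => a = Var w
  | STm P => forall k, unfolds_p (n + k) (mren_p (shift n k) P) a
  end.

Lemma unfolds_e_sub n s th d E e rho : substitutes n s th -> length th <= d ->
  unfolds_e d E e rho ->
  unfolds_e (d - length th + n) (sub_e (length th) n s d E) e (map (esub (assign th n)) rho)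
with unfolds_g_sub n s th d T x r Q rho : substitutes n s th -> length th <= d ->
  unfolds_g d T x r Q rho ->
  unfolds_g (d - length th + n) (sub_g (length th) n s d T) x r Q (map (esub (assign th n)) rho)
with unfolds_p_sub n s th d P a : substitutes n s th -> length th <= d -> unfolds_p d P a ->
  unfolds_p (d - length th + n) (sub_p (length th) n s d P) (esub (assign th n) a).
Proof.
- intros Hs Hd. destruct 1 as [| |d T B x r Q B' rho HT HB]; rewrite sub_e_eq; constructor.
  + apply unfolds_g_sub; assumption.
  + intros i. apply unfolds_e_sub; [assumption | assumption | apply HB].
- intros Hs Hd. destruct 1 as [d w x r Q Q' rho Hx HQ | d P a x r Q Q' rho Hx HP HQ];
    rewrite sub_g_eq;
    assert (HQ' : forall i, i < r -> unfolds_p (d - length th + n) (sub_p (length th) n s d (Q i))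
      (Clo (Q' i) (map (esub (assign th n)) rho)))
    by (intros i Hi; apply (unfolds_p_sub n s th d (Q i) (Clo (Q' i) rho));
        [assumption | assumption | exact (HQ i Hi)]).
  + apply (map_nth_error (esub (assign th n))) in Hx. simpl in Hx.
    destruct (Nat.ltb_spec w (length th)) as [Hw|Hw].
    * destruct (nth_error_exists th w Hw) as [a Ha]. rewrite (assign_nth_error Ha) in Hx.
      specialize (Hs w a Ha). destruct (s w) as [w'|P].
      -- subst a. constructor; [exact Hx | exact HQ'].
      -- econstructor; [exact Hx | | exact HQ']. rewrite (Nat.add_comm _ n). apply Hs.
    * rewrite assign_ge in Hx by exact Hw. constructor; [exact Hx | exact HQ'].
  + econstructor; [apply map_nth_error, Hx | | exact HQ'].
    apply unfolds_p_sub; assumption.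
- intros Hs Hd. destruct 1 as [d ts A a e rho Ha HA]. rewrite sub_p_eq. econstructor.
  + rewrite <- map_assign_vars_ge by assumption. apply enters_esub. exact Ha.
  + replace (d - length th + n + length ts) with (d + length ts - length th + n) by lia.
    apply unfolds_e_sub; [assumption | lia | exact HA].
Qed.

Lemma substitutes_args D us bs (P : nat -> mproc) : typed_env D us bs ->
  (forall i b, nth_error bs i = Some b -> unfolds_p (length D) (P i) b) ->
  substitutes (length D) (fun v => if v <? length D then SVar v else STm (P (v - length D)))
    (id_env D ++ bs).
Proof.
intros Hbs HP v a Ha. rewrite nth_error_app, length_vars in Ha.
destruct (Nat.ltb_spec v (length D)) as [Hv|Hv].
- rewrite nth_error_vars in Ha by exact Hv. injection Ha as <-. reflexivity.
- intros k. destruct (nth_error_exists us (v - length D)) as [t Ht].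
  { rewrite (Forall2_length Hbs). exact (nth_error_lt Ha). }
  destruct (Forall2_nth_error_l Hbs Ht) as (b & Hb & Htb).
  rewrite Ha in Hb. injection Hb as <-. apply (unfolds_p_weaken D t); auto.
Qed.

(** * Reduction of meta-terms follows the machine *)

Lemma unfolds_beta D us A e a rho0 (Q : nat -> mproc) Q' G rho :
  typed_entry D (Arr us) a -> typed_env D G rho ->
  (forall i t, nth_error us i = Some t -> typed_p G (Q' i) t) ->
  (forall i, i < length us -> unfolds_p (length D) (Q i) (Clo (Q' i) rho)) ->
  enters a (fresh D us) us e rho0 ->
  unfolds_e (length D + length us) A e rho0 ->
  exists rho1, enters a (closures (length us) Q' rho) us e rho1 /\
    unfolds_e (length D)
      (sub_e (length D + length us) (length D)
         (fun v => if v <? length D then SVar v else STm (Q (v - length D)))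
         (length D + length us) A) e rho1.
Proof.
intros Ha Hrho HQ' HQ Hent HA.
set (bs := closures (length us) Q' rho). set (th := id_env D ++ bs).
pose proof (typed_closures HQ' Hrho) as Hbs. fold bs in Hbs.
assert (Hl : length bs = length us) by apply length_closures.
assert (Hth : length th = length D + length us)
  by (unfold th; rewrite length_app, length_vars; lia).
exists (map (esub (assign th (length D))) rho0). split.
- apply (enters_esub (assign th (length D))) in Hent.
  assert (Ev : map (esub (assign th (length D))) (fresh D us) = bs).
  { pose proof (map_assign_vars_app (id_env D) bs (length D)) as [_ E].
    rewrite length_vars, Hl in E. exact E. }
  rewrite Ev, (esub_id Ha) in Hent; [exact Hent|].
  intros w Hw. apply assign_nth_error, nth_error_prefix, (nth_error_vars 0), Hw.
- rewrite <- Hth. rewrite <- (Nat.add_0_l (length D)) at 1.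
  rewrite <- (Nat.sub_diag (length th)).
  apply unfolds_e_sub; [|apply Nat.le_refl | rewrite Hth; exact HA].
  apply (substitutes_args D us); [exact Hbs|]. intros i b Hb.
  pose proof (nth_error_lt Hb) as Hi. rewrite Hl in Hi.
  unfold bs in Hb. rewrite nth_error_closures in Hb by exact Hi. injection Hb as <-. apply HQ, Hi.
Qed.

(* [E] is [e] in [rho] under the branches of the frames [K], which reduction turns from nested
   cases ([unfolds_GE]) into commuted ones ([unfolds_commuted]). *)
CoInductive unfolds_stack (d : nat) : mexpr -> expr -> list entry -> list frame -> Prop :=
| unfolds_nil : forall E e rho, unfolds_e d E e rho -> unfolds_stack d E e rho []
| unfolds_stack_Bot : forall rho K, unfolds_stack d MBot Bot rho K
| unfolds_commuted : forall T B x r Q B' rho K,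
    unfolds_g d T x r Q rho -> (forall i, unfolds_stack d (B i) (B' i) rho K) ->
    unfolds_stack d (MCase T B) (Case x r Q B') rho K
| unfolds_GE : forall E B e rho B' rho' K,
    unfolds_e d E e rho -> (forall n, unfolds_stack d (B n) (B' n) rho' K) ->
    unfolds_stack d (MCase (GE E) B) e rho ((B', rho') :: K).

(* A head [GE] may reduce without a machine step, but only once. *)
Definition head_GE (E : mexpr) : nat := match E with MCase (GE _) _ => 1 | _ => 0 end.

Lemma head_GE_le E : head_GE E <= 1.
Proof. destruct E as [| |[] ?]; simpl; lia. Qed.

Lemma head_GE_unfolds_g [d T x r Q rho B] : unfolds_g d T x r Q rho -> head_GE (MCase T B) = 0.
Proof. destruct 1; reflexivity. Qed.

Lemma hstep_unfolds_Case D T B x r Q B' rho K E' : typed_state D (Eval (Case x r Q B') rho K) ->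
  unfolds_g (length D) T x r Q rho -> (forall i, unfolds_stack (length D) (B i) (B' i) rho K) ->
  hstep (length D) (MCase T B) = Some E' ->
  exists j e rho1, steps (S j) (Eval (Case x r Q B') rho K) (Eval e rho1 ((B', rho) :: K)) /\
    unfolds_stack (length D) E' e rho1 ((B', rho) :: K).
Proof.
intros Hs HT HB Hred. inversion Hs as [G e rho1 K1 He Hrho HK | |]; subst.
inversion He as [| |G1 x1 us Q1 B1 Hx HQ HB1]; subst.
inversion HT as [d w x1 r1 Q1 Q2 rho1 Hw HQ1 | d P a x1 r1 Q1 Q2 rho1 Ha HP HQ1]; subst;
  [discriminate|].
destruct (Forall2_nth_error_l Hrho Hx) as (a' & Ha' & Hta).
rewrite Ha in Ha'. injection Ha' as <-.
inversion HP as [d ts A a1 e rho0 Hent HA]; subst. injection Hred as <-.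
pose proof (enters_typed Hent Hta) as ->.
destruct (unfolds_beta D us A e a rho0 Q1 Q G rho Hta Hrho HQ HQ1 Hent HA) as (rho1 & Hent1 & Hsub).
destruct (enters_steps ((B', rho) :: K) Hent1) as [j Hj].
exists (S j), e, rho1. split.
- econstructor; [simpl; rewrite Ha; reflexivity | exact Hj].
- constructor; assumption.
Qed.

Lemma hstep_unfolds [D E E' e rho K] : typed_state D (Eval e rho K) ->
  unfolds_stack (length D) E e rho K -> hstep (length D) E = Some E' ->
  exists j e' rho' K', steps j (Eval e rho K) (Eval e' rho' K') /\
    unfolds_stack (length D) E' e' rho' K' /\ head_GE E' < 2 * j + head_GE E.
Proof.
intros Hs HE Hred. pose proof (head_GE_le E') as HE'.
destruct HE as [E e rho HE | | T B x r Q B' rho K HT HB | E B e rho B' rho' K HE HB].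
- inversion HE as [| |d T B x r Q B' rho1 HT HB]; subst; try discriminate.
  destruct (hstep_unfolds_Case D T B x r Q B' rho [] E' Hs HT) as (j & e & rho1 & Hj & Hu);
    [intros i; constructor; apply HB | exact Hred |].
  do 4 eexists. split; [exact Hj | split; [exact Hu | lia]].
- discriminate.
- destruct (hstep_unfolds_Case D T B x r Q B' rho K E' Hs HT HB Hred) as (j & e & rho1 & Hj & Hu).
  do 4 eexists. split; [exact Hj | split; [exact Hu | lia]].
- inversion HE as [d rho1|d n rho1|d T B1 x r Q B2 rho1 HT HB1]; subst; injection Hred as <-.
  + exists 0, Bot, rho, ((B', rho') :: K). repeat split; [constructor | constructor | simpl; lia].
  + exists 2, (B' n), rho', K. split; [|split; [apply HB | lia]].
    econstructor; [reflexivity | apply steps_1; reflexivity].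
  + exists 0, (Case x r Q B2), rho, ((B', rho') :: K). split; [constructor | split].
    * constructor; [exact HT|]. intros i. constructor; [apply HB1 | exact HB].
    * rewrite (head_GE_unfolds_g HT). simpl. lia.
Qed.

Lemma hred_unfolds [D] n [E e rho K] : typed_state D (Eval e rho K) ->
  unfolds_stack (length D) E e rho K ->
  exists j e' rho' K', steps j (Eval e rho K) (Eval e' rho' K') /\
    unfolds_stack (length D) (hred (length D) n E) e' rho' K'.
Proof.
revert E e rho K. induction n as [|n IH]; intros E e rho K Hs HE; simpl;
  [|destruct (hstep (length D) E) as [E'|] eqn:Hred];
  try (exists 0, e, rho, K; split; [constructor | exact HE]).
destruct (hstep_unfolds Hs HE Hred) as (j & e1 & rho1 & K1 & Hj & HE1 & _).
destruct (IH _ _ _ _ (typed_steps Hj Hs) HE1) as (k & e2 & rho2 & K2 & Hk & HE2).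
exists (j + k), e2, rho2, K2. split; [exact (steps_trans Hj Hk) | exact HE2].
Qed.

Lemma hred_terminates [D E e rho K v] : typed_state D (Eval e rho K) ->
  unfolds_stack (length D) E e rho K -> converges (Eval e rho K) v ->
  exists j, hstep (length D) (hred (length D) j E) = None.
Proof.
intros Hs HE [n Hv]. remember (2 * n + head_GE E) as m eqn:Em. revert n E e rho K Em Hs HE Hv.
induction m as [m IH] using lt_wf_ind. intros n E e rho K -> Hs HE Hv.
destruct (hstep (length D) E) as [E'|] eqn:Hred; [|exists 0; exact Hred].
destruct (hstep_unfolds Hs HE Hred) as (j & e1 & rho1 & K1 & Hj & HE1 & Hlt).
destruct (evaluates_steps Hj Hv) as (n1 & -> & Hv1).
destruct (IH (2 * n1 + head_GE E') ltac:(lia) n1 _ _ _ _ eq_refl (typed_steps Hj Hs) HE1 Hv1)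
  as [i Hi].
exists (S i). simpl. rewrite Hred. exact Hi.
Qed.

Lemma nfe_eq d E : nfe d E =
  match hnf d E with
  | Some (MNum n) => Num n
  | Some (MCase (GVar x r Q) B) => Case x r (fun i => nfp d (Q i)) (fun i => nfe d (B i))
  | _ => Bot
  end.
Proof.
rewrite (expr_eta (nfe d E)). simpl. destruct (hnf d E) as [[| |[] ?]|]; reflexivity.
Qed.

Lemma nfp_eq d ts E : nfp d (MLam ts E) = Lam ts (nfe (d + length ts) E).
Proof. rewrite (proc_eta (nfp d (MLam ts E))). reflexivity. Qed.

Lemma hnf_cases d E :
  (exists n, hnf d E = Some (hred d n E) /\ hstep d (hred d n E) = None) \/
  (hnf d E = None /\ forall n, hstep d (hred d n E) <> None).
Proof.
unfold hnf. destruct excluded_middle_informative as [H|H]; [left | right; split; eauto].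
destruct constructive_indefinite_description as [n Hn]; simpl. eauto.
Qed.

Inductive unfolds_hnf (d : nat) : mexpr -> expr -> list entry -> list frame -> Prop :=
| hnf_Bot : forall rho K, unfolds_hnf d MBot Bot rho K
| hnf_Num : forall n rho, unfolds_hnf d (MNum n) (Num n) rho []
| hnf_Case : forall w x r Q B Q' B' rho K,
    nth_error rho x = Some (Var w) -> (forall i, i < r -> unfolds_p d (Q i) (Clo (Q' i) rho)) ->
    (forall i, unfolds_stack d (B i) (B' i) rho K) ->
    unfolds_hnf d (MCase (GVar w r Q) B) (Case x r Q' B') rho K.

Lemma unfolds_stack_hnf [d E e rho K] : unfolds_stack d E e rho K -> hstep d E = None ->
  unfolds_hnf d E e rho K.
Proof.
assert (HCase : forall T B x r Q B' rho K, unfolds_g d T x r Q rho ->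
  (forall i, unfolds_stack d (B i) (B' i) rho K) -> hstep d (MCase T B) = None ->
  unfolds_hnf d (MCase T B) (Case x r Q B') rho K).
{ intros T B x r Q B' rho1 K1 HT HB Hred.
  destruct HT as [|d P a x r Q Q' rho1 Hx []]; [constructor; assumption | discriminate]. }
intros [E1 e1 rho1 HE | | | E1 B e1 rho1 B' rho' K1 HE HB] Hred; auto using hnf_Bot.
- destruct HE; auto using hnf_Bot, hnf_Num. apply HCase; auto. intros i. constructor. auto.
- destruct HE; discriminate.
Qed.

Lemma nfe_nf D E e rho K : typed_state D (Eval e rho K) -> unfolds_stack (length D) E e rho K ->
  eeq (nfe (length D) E) (nf D (Eval e rho K))
with nfp_nf_entry D P t a : typed_entry D t a -> unfolds_p (length D) P a ->
  peq (nfp (length D) P) (nf_entry D t a).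
Proof.
- intros Hs HE. rewrite nfe_eq. destruct (hnf_cases (length D) E) as [(n & -> & Hn) | [-> Hn]].
  + destruct (hred_unfolds n Hs HE) as (j & e' & rho' & K' & Hj & HE').
    rewrite (nf_steps Hj). apply (typed_steps Hj) in Hs.
    destruct (unfolds_stack_hnf HE' Hn) as [rho1 K1 | k rho1
      | w x r Q B Q' B' rho1 K1 Hx HQ HB].
    * rewrite nf_Eval_Bot. constructor.
    * rewrite nf_Eval_Num. constructor.
    * assert (Hstep : step (Eval (Case x r Q' B') rho1 K1) =
        Some (Call (Var w) (closures r Q' rho1) ((B', rho1) :: K1)))
      by (simpl; rewrite Hx; reflexivity).
      rewrite (nf_step _ _ _ Hstep).
      pose proof (typed_step Hs Hstep) as Hs'.
      inversion Hs' as [|ts a bs K2 Hw Hbs HK|]; subst. apply typed_Var_inv in Hw.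
      pose proof (Forall2_length Hbs) as Hr. rewrite length_closures in Hr. subst r.
      rewrite (nf_Call_Var Hw). constructor.
      -- intros i Hi. apply nfp_nf_entry.
         ++ exact (Forall2_nth _ _ Hbs Hi).
         ++ rewrite nth_closures by exact Hi. exact (HQ i Hi).
      -- intros i. rewrite (nf_step _ _ (Eval (B' i) rho1 K1)) by reflexivity.
         apply nfe_nf; [|apply HB]. inversion HK as [|F K3 (G & Hrho & HB') HK']; subst.
         exact (typed_Eval D G _ _ _ (HB' i) Hrho HK').
  + rewrite nf_diverges; [constructor|]. intros v Hv.
    destruct (hred_terminates Hs HE Hv) as [j Hj]. exact (Hn j Hj).
- intros Ha HP. destruct t as [us]. destruct P as [ts A].
  inversion HP as [d ts' A' a' e rho Hent HA]; subst.
  pose proof (enters_typed Hent Ha) as ->.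
  destruct (enters_steps [] Hent) as [j Hj].
  rewrite nfp_eq, nf_entry_eq. constructor. rewrite (nf_steps Hj), <- length_app.
  apply nfe_nf.
  + apply (typed_steps Hj). econstructor; [|apply typed_fresh | constructor].
    apply typed_entry_weaken, Ha.
  + constructor. rewrite length_app. exact HA.
Qed.

Lemma typed_Call_id [G p q t ts] : typed_p G p (Arr (t :: ts)) -> typed_p G q t ->
  let id := id_env G in
  typed_state (G ++ ts) (Call (Clo p id) (Clo q id :: fresh G ts) []).
Proof.
intros Hp Hq id. econstructor; [| |constructor].
- apply typed_entry_weaken. econstructor; [exact Hp | apply typed_id_env].
- constructor; [|apply typed_fresh].
  apply typed_entry_weaken. econstructor; [exact Hq | apply typed_id_env].
Qed.

Lemma app_nf G p q t ts : typed_p G p (Arr (t :: ts)) -> typed_p G q t ->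
  let id := id_env G in
  peq (Defs.app (length G) p q)
    (Lam ts (nf (G ++ ts) (Call (Clo p id) (Clo q id :: fresh G ts) []))).
Proof.
intros Hp Hq id. destruct p as [ts1 e]. destruct (typed_Lam_inv Hp) as [E He].
injection E as <-. simpl Defs.app. constructor.
set (rho := id ++ [Clo q id]).
assert (Hrho : length rho = length G + 1)
  by (unfold rho, id; rewrite length_app, length_vars; reflexivity).
erewrite nf_step by reflexivity. rewrite <- length_app. apply nfe_nf.
- exact (typed_step (typed_Call_id Hp Hq) eq_refl).
- constructor. pose proof (unfolds_e_embed _ _ He) as Hemb.
  replace (length (G ++ t :: ts)) with (length rho + length ts) in Hemb
    by (rewrite Hrho, length_app; simpl; lia).
  replace (id ++ Clo q id :: _) with (rho ++ fresh G ts)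
    by (unfold rho; rewrite <- app_assoc; reflexivity).
  rewrite <- map_assign_vars_add, <- Hrho.
  replace (length (G ++ ts)) with (length rho + length ts - length rho + length G)
    by (rewrite length_app; lia).
  apply unfolds_e_sub; [|lia | exact Hemb].
  apply (substitutes_args G [t] [Clo q id] (fun _ => embed_p q)).
  + constructor; [|constructor]. econstructor; [exact Hq | apply typed_id_env].
  + intros [|[|i]] b; try discriminate. intros [= <-]. exact (unfolds_p_embed _ _ _ Hq).
Qed.

(** * Plugging *)

Lemma pick_cases P : (exists m, pick P = Some m /\ P m) \/ (pick P = None /\ forall m, ~ P m).
Proof.
unfold pick. destruct excluded_middle_informative as [H|H]; [left | right; split; eauto].
destruct constructive_indefinite_description as [m Hm]; simpl. eauto.
Qed.

Lemma lub_e_eq c : lub_e c =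
  match pick (fun m => is_mbot (c m) = false) with
  | None => MBot
  | Some m =>
      match c m with
      | MBot => MBot
      | MNum n => MNum n
      | MCase _ _ => MCase (lub_g (fun j => caseG (c (m + j))))
                           (fun i => lub_e (fun j => caseB i (c (m + j))))
      end
  end.
Proof.
rewrite (mexpr_eta (lub_e c)). simpl. destruct (pick _) as [m|]; [|reflexivity].
destruct (c m); reflexivity.
Qed.

Lemma lub_g_eq c : lub_g c =
  match pick (fun m => is_GE (c m) = false) with
  | None => GE (lub_e (fun j => unGE (c j)))
  | Some m =>
      match c m with
      | GVar x r _ => GVar x r (fun i => lub_p (fun j => argG i (c (m + j))))
      | GApp _ r _ => GApp (lub_p (fun j => headP (c (m + j)))) r
                           (fun i => lub_p (fun j => argG i (c (m + j))))
      | GE _ => GE (lub_e (fun j => unGE (c (m + j))))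
      end
  end.
Proof.
rewrite (mground_eta (lub_g c)). simpl. destruct (pick _) as [m|]; [|reflexivity].
destruct (c m); reflexivity.
Qed.

Lemma lub_p_MLam c ts E : (forall j, c j = MLam ts (E j)) -> lub_p c = MLam ts (lub_e E).
Proof.
intros Hc. apply functional_extensionality in Hc. subst c.
rewrite (mproc_eta (lub_p _)). reflexivity.
Qed.

Definition tail {A} (c : nat -> A) (m j : nat) : A := c (m + j).

Lemma tail_tail {A} (c : nat -> A) m m' : tail (tail c m) m' = tail c (m + m').
Proof. apply functional_extensionality. intros j. unfold tail. f_equal. lia. Qed.

Lemma lub_e_MBot c : (forall j, c j = MBot) -> lub_e c = MBot.
Proof. intros Hc. rewrite lub_e_eq. destruct (pick _) as [m|]; [rewrite Hc|]; reflexivity. Qed.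

Lemma lub_e_MNum c n : (forall j, c j = MNum n) -> lub_e c = MNum n.
Proof.
intros Hc. rewrite lub_e_eq.
destruct (pick_cases (fun m => is_mbot (c m) = false)) as [(m & -> & _) | [_ H]].
- rewrite Hc. reflexivity.
- destruct (H 0). rewrite Hc. reflexivity.
Qed.

Lemma lub_e_MCase c T B : (forall j, c j = MCase (T j) (fun i => B i j)) ->
  exists m, lub_e c = MCase (lub_g (tail T m)) (fun i => lub_e (tail (B i) m)).
Proof.
intros Hc. apply functional_extensionality in Hc. subst c. rewrite lub_e_eq.
destruct (pick_cases (fun m => is_mbot (MCase (T m) (fun i => B i m)) = false))
  as [(m & -> & _) | [_ H]]; [exists m; reflexivity | destruct (H 0 eq_refl)].
Qed.

Lemma lub_g_GVar c w r Q : (forall j, c j = GVar w r (fun i => Q i j)) ->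
  exists m, lub_g c = GVar w r (fun i => lub_p (tail (Q i) m)).
Proof.
intros Hc. apply functional_extensionality in Hc. subst c. rewrite lub_g_eq.
destruct (pick_cases (fun m => is_GE (GVar w r (fun i => Q i m)) = false))
  as [(m & -> & _) | [_ H]]; [exists m; reflexivity | destruct (H 0 eq_refl)].
Qed.

Lemma lub_g_GApp k c P r Q : (forall j, j < k -> c j = GE MBot) ->
  (forall j, k <= j -> c j = GApp (P j) r (fun i => Q i j)) ->
  exists m, k <= m /\ lub_g c = GApp (lub_p (tail P m)) r (fun i => lub_p (tail (Q i) m)).
Proof.
intros Hlt Hge. rewrite lub_g_eq.
destruct (pick_cases (fun m => is_GE (c m) = false)) as [(m & -> & Hm) | [_ H]].
- assert (Hkm : k <= m) by (apply Nat.nlt_ge; intros H; rewrite Hlt in Hm; easy).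
  exists m. split; [exact Hkm|]. rewrite (Hge m Hkm). unfold tail. f_equal.
  + f_equal. apply functional_extensionality. intros j. rewrite Hge by lia. reflexivity.
  + apply functional_extensionality. intros i. f_equal.
    apply functional_extensionality. intros j. rewrite Hge by lia. reflexivity.
- destruct (H k). rewrite Hge; reflexivity.
Qed.

Lemma circ_e_eq lo hi E : circ_e lo hi E =
  match E with
  | MBot => MBot
  | MNum n => MNum n
  | MCase G B => MCase (circ_g lo hi G) (fun i => circ_e lo hi (B i))
  end.
Proof. rewrite (mexpr_eta (circ_e lo hi E)). destruct E; reflexivity. Qed.

Lemma circ_g_eq lo hi G : circ_g lo hi G =
  match G with
  | GE E => GE (circ_e lo hi E)
  | GVar x r Q => if andb (lo <=? x) (x <? hi) then GE MBot
                  else GVar x r (fun i => circ_p lo hi (Q i))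
  | GApp P r Q => GApp (circ_p lo hi P) r (fun i => circ_p lo hi (Q i))
  end.
Proof.
rewrite (mground_eta (circ_g lo hi G)). destruct G; simpl; try reflexivity.
destruct (andb _ _); reflexivity.
Qed.

Lemma circ_p_eq lo hi ts E : circ_p lo hi (MLam ts E) = MLam ts (circ_e lo hi E).
Proof. rewrite (mproc_eta (circ_p lo hi (MLam ts E))). reflexivity. Qed.

Section PlugLimit.

(* The plugged variables are those in [lo, n). *)
Variables (lo n : nat) (s : nat -> sval).

Definition approx_e (d m : nat) (E : mexpr) : mexpr := circ_e lo n (Nat.iter m (sub_e n n s d) E).
Definition approx_g (d m : nat) (T : mground) : mground :=
  circ_g lo n (Nat.iter m (sub_g n n s d) T).
Definition approx_p (d m : nat) (P : mproc) : mproc := circ_p lo n (Nat.iter m (sub_p n n s d) P).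

Definition limit_e (d m : nat) (E : mexpr) : mexpr := lub_e (tail (fun k => approx_e d k E) m).
Definition limit_g (d m : nat) (T : mground) : mground := lub_g (tail (fun k => approx_g d k T) m).
Definition limit_p (d m : nat) (P : mproc) : mproc := lub_p (tail (fun k => approx_p d k P) m).

Lemma approx_e_S d m E : approx_e d (S m) E = approx_e d m (sub_e n n s d E).
Proof. unfold approx_e. rewrite Nat.iter_succ_r. reflexivity. Qed.

Lemma approx_g_S d m T : approx_g d (S m) T = approx_g d m (sub_g n n s d T).
Proof. unfold approx_g. rewrite Nat.iter_succ_r. reflexivity. Qed.

Lemma approx_p_S d m P : approx_p d (S m) P = approx_p d m (sub_p n n s d P).
Proof. unfold approx_p. rewrite Nat.iter_succ_r. reflexivity. Qed.

Lemma approx_e_eq d m E : approx_e d m E =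
  match E with
  | MBot => MBot
  | MNum k => MNum k
  | MCase T B => MCase (approx_g d m T) (fun i => approx_e d m (B i))
  end.
Proof.
revert E. induction m as [|m IH]; intros E; [apply circ_e_eq|].
rewrite approx_e_S, sub_e_eq, IH. destruct E as [| |T B]; try reflexivity.
rewrite approx_g_S. f_equal. apply functional_extensionality. intros i. symmetry. apply approx_e_S.
Qed.

Lemma approx_p_eq d m ts E : approx_p d m (MLam ts E) = MLam ts (approx_e (d + length ts) m E).
Proof.
revert E. induction m as [|m IH]; intros E; [apply circ_p_eq|].
rewrite approx_p_S, sub_p_eq, IH, approx_e_S. reflexivity.
Qed.

Lemma approx_args_S d m (Q : nat -> mproc) :
  (fun i => approx_p d m (sub_p n n s d (Q i))) = (fun i => approx_p d (S m) (Q i)).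
Proof. apply functional_extensionality. intros i. symmetry. apply approx_p_S. Qed.

Lemma approx_g_GApp d m P r Q :
  approx_g d m (GApp P r Q) = GApp (approx_p d m P) r (fun i => approx_p d m (Q i)).
Proof.
revert P Q. induction m as [|m IH]; intros P Q; [apply circ_g_eq|].
rewrite approx_g_S, sub_g_eq, IH, approx_args_S, approx_p_S. reflexivity.
Qed.

Lemma approx_g_free d m w r Q : (w < lo /\ s w = SVar w) \/ n <= w ->
  approx_g d m (GVar w r Q) = GVar w r (fun i => approx_p d m (Q i)).
Proof.
intros Hw. revert Q. induction m as [|m IH]; intros Q.
- unfold approx_g. simpl. rewrite circ_g_eq.
  destruct (Nat.leb_spec lo w), (Nat.ltb_spec w n); try reflexivity. lia.
- rewrite approx_g_S, sub_g_eq.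
  assert (E : (if w <? n then match s w with
      | SVar w' => GVar w' r (fun i => sub_p n n s d (Q i))
      | STm P => GApp (mren_p (shift n (d - n)) P) r (fun i => sub_p n n s d (Q i)) end
    else GVar (w - n + n) r (fun i => sub_p n n s d (Q i))) =
    GVar w r (fun i => sub_p n n s d (Q i))).
  { destruct (Nat.ltb_spec w n); [|f_equal; lia]. destruct Hw as [[_ ->]|]; [reflexivity | lia]. }
  rewrite E, IH, approx_args_S. reflexivity.
Qed.

Lemma approx_g_plugged_0 d w r Q : lo <= w < n -> approx_g d 0 (GVar w r Q) = GE MBot.
Proof.
intros [Hlo Hn]. unfold approx_g. simpl. rewrite circ_g_eq.
apply Nat.leb_le in Hlo. apply Nat.ltb_lt in Hn. rewrite Hlo, Hn. reflexivity.
Qed.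

Lemma approx_g_plugged_S d m w r Q P : w < n -> s w = STm P ->
  approx_g d (S m) (GVar w r Q) =
  GApp (approx_p d m (mren_p (shift n (d - n)) P)) r (fun i => approx_p d (S m) (Q i)).
Proof.
intros Hn Hs. apply Nat.ltb_lt in Hn.
rewrite approx_g_S, sub_g_eq, Hn, Hs, approx_g_GApp, approx_args_S. reflexivity.
Qed.

Lemma limit_e_MBot d m : limit_e d m MBot = MBot.
Proof. apply lub_e_MBot. intros j. apply approx_e_eq. Qed.

Lemma limit_e_MNum d m k : limit_e d m (MNum k) = MNum k.
Proof. apply lub_e_MNum. intros j. apply approx_e_eq. Qed.

Lemma limit_e_MCase d m T B : exists m', limit_e d m (MCase T B) =
  MCase (limit_g d m' T) (fun i => limit_e d m' (B i)).
Proof.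
destruct (lub_e_MCase (tail (fun k => approx_e d k (MCase T B)) m)
  (tail (fun k => approx_g d k T) m) (fun i => tail (fun k => approx_e d k (B i)) m)) as [m' E].
{ intros j. apply approx_e_eq. }
exists (m + m'). unfold limit_e at 1. rewrite E, tail_tail. f_equal.
apply functional_extensionality. intros i. rewrite tail_tail. reflexivity.
Qed.

Lemma limit_g_free d m w r Q : (w < lo /\ s w = SVar w) \/ n <= w ->
  exists m', limit_g d m (GVar w r Q) = GVar w r (fun i => limit_p d m' (Q i)).
Proof.
intros Hw. destruct (lub_g_GVar (tail (fun k => approx_g d k (GVar w r Q)) m) w r
  (fun i => tail (fun k => approx_p d k (Q i)) m)) as [m' E].
{ intros j. apply approx_g_free, Hw. }
exists (m + m'). unfold limit_g. rewrite E. f_equal.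
apply functional_extensionality. intros i. rewrite tail_tail. reflexivity.
Qed.

Lemma limit_g_GApp d m P r Q : exists m', limit_g d m (GApp P r Q) =
  GApp (limit_p d m' P) r (fun i => limit_p d m' (Q i)).
Proof.
destruct (lub_g_GApp 0 (tail (fun k => approx_g d k (GApp P r Q)) m)
  (tail (fun k => approx_p d k P) m) r (fun i => tail (fun k => approx_p d k (Q i)) m))
  as (m' & _ & E); [lia | intros j _; apply approx_g_GApp |].
exists (m + m'). unfold limit_g. rewrite E, tail_tail. f_equal.
apply functional_extensionality. intros i. rewrite tail_tail. reflexivity.
Qed.

Lemma limit_g_plugged d m w r Q P : lo <= w < n -> s w = STm P ->
  exists m1 m2, limit_g d m (GVar w r Q) =
    GApp (limit_p d m1 (mren_p (shift n (d - n)) P)) r (fun i => limit_p d m2 (Q i)).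
Proof.
intros Hw Hs. set (P' := mren_p (shift n (d - n)) P).
destruct (lub_g_GApp (1 - m) (tail (fun k => approx_g d k (GVar w r Q)) m)
  (fun j => approx_p d (m + j - 1) P') r (fun i => tail (fun k => approx_p d k (Q i)) m))
  as (m' & Hm' & E).
- intros j Hj. unfold tail. replace (m + j) with 0 by lia. apply approx_g_plugged_0, Hw.
- intros j Hj. unfold tail. destruct (m + j) as [|k] eqn:Ek; [lia|]. simpl.
  rewrite Nat.sub_0_r. apply approx_g_plugged_S; tauto.
- exists (m + m' - 1), (m + m'). unfold limit_g. rewrite E. f_equal.
  + unfold limit_p. f_equal. apply functional_extensionality. intros j. unfold tail. f_equal. lia.
  + apply functional_extensionality. intros i. rewrite tail_tail. reflexivity.
Qed.

Lemma limit_p_MLam d m ts E : limit_p d m (MLam ts E) = MLam ts (limit_e (d + length ts) m E).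
Proof. apply lub_p_MLam. intros j. apply approx_p_eq. Qed.

(* [th] solves the recursion that [s] unfolds: the meta-procedure plugged in for [w] unfolds to an
   entry whose instance by [th] is [th w] itself. *)
Variable th : nat -> entry.
Hypothesis th_free : forall w, w < lo \/ n <= w -> th w = Var w.
Hypothesis s_free : forall w, w < lo -> s w = SVar w.
Hypothesis th_plugged : forall w d, lo <= w < n -> n <= d -> exists P ts A e rho,
  s w = STm P /\ mren_p (shift n (d - n)) P = MLam ts A /\
  unfolds_e (d + length ts) A e rho /\
  enters (th w) (vars d (length ts)) ts e (map (esub th) rho).

Lemma unfolds_e_limit d m E e rho : n <= d -> unfolds_e d E e rho ->
  unfolds_e d (limit_e d m E) e (map (esub th) rho)
with unfolds_g_limit d m T x r Q rho : n <= d -> unfolds_g d T x r Q rho ->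
  unfolds_g d (limit_g d m T) x r Q (map (esub th) rho)
with unfolds_p_limit d m P a : n <= d -> unfolds_p d P a ->
  unfolds_p d (limit_p d m P) (esub th a).
Proof.
- intros Hd. destruct 1 as [d rho | d k rho | d T B x r Q B' rho HT HB].
  + rewrite limit_e_MBot. constructor.
  + rewrite limit_e_MNum. constructor.
  + destruct (limit_e_MCase d m T B) as [m' ->]. constructor.
    * apply unfolds_g_limit; assumption.
    * intros i. apply unfolds_e_limit; [assumption | apply HB].
- intros Hd. destruct 1 as [d w x r Q Q' rho Hx HQ | d P a x r Q Q' rho Hx HP HQ];
    apply (map_nth_error (esub th)) in Hx; simpl in Hx.
  + destruct (le_lt_dec lo w) as [Hlo|Hlo]; [destruct (le_lt_dec n w) as [Hn|Hn]|].
    2:{ destruct (th_plugged w d (conj Hlo Hn) Hd) as (P & ts & A & e & rho0 & Hs & HP & HA & Hent).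
        destruct (limit_g_plugged d m w r Q P (conj Hlo Hn) Hs) as (m1 & m2 & ->).
        rewrite HP, limit_p_MLam. econstructor; [exact Hx | |].
        - econstructor; [exact Hent|]. apply unfolds_e_limit; [lia | exact HA].
        - intros i Hi.
          apply (unfolds_p_limit d m2 (Q i) (Clo (Q' i) rho)); [assumption | exact (HQ i Hi)]. }
    all: rewrite th_free in Hx by auto.
    all: destruct (limit_g_free d m w r Q) as [m' ->]; [auto|].
    all: constructor; [exact Hx|]; intros i Hi;
      apply (unfolds_p_limit d m' (Q i) (Clo (Q' i) rho)); [assumption | exact (HQ i Hi)].
  + destruct (limit_g_GApp d m P r Q) as [m' ->]. econstructor; [exact Hx | |].
    * apply unfolds_p_limit; assumption.
    * intros i Hi.
      apply (unfolds_p_limit d m' (Q i) (Clo (Q' i) rho)); [assumption | exact (HQ i Hi)].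
- intros Hd. destruct 1 as [d ts A a e rho Ha HA]. rewrite limit_p_MLam. econstructor.
  + rewrite <- (map_esub_vars_shift th d d) by (intros i; apply th_free; lia).
    apply enters_esub. exact Ha.
  + apply unfolds_e_limit; [lia | exact HA].
Qed.

End PlugLimit.

Lemma unfolds_e_lift k j d l E e : k + j <= d -> unfolds_e (k + l) E e (vars 0 (k + l)) ->
  unfolds_e (d + l) (mren_e (shift (k + j) (d - (k + j))) (mren_e (shift k j) E)) e
    (vars 0 k ++ vars d l).
Proof.
intros Hd HE. apply (unfolds_e_mren k j) in HE; [|lia].
apply (unfolds_e_mren (k + j) (d - (k + j))) in HE; [|lia].
replace (k + l + j + (d - (k + j))) with (d + l) in HE by lia.
rewrite <- (vars_app 0 k), !map_app, !map_shift_vars_le, !map_shift_vars_ge in HE by lia.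
replace (0 + k + j + (d - (k + j))) with d in HE by lia. exact HE.
Qed.

Definition plug_subst (g : nat) (ss : list ty) (e : expr) (qs : nat -> proc) (v : nat) : sval :=
  let r := length ss in
  if v <? g then SVar v
  else if v =? g then STm (MLam ss (mren_e (shift (g + 1) r) (embed_e e)))
  else STm (mren_p (shift g (1 + r)) (embed_p (qs (v - g - 1)))).

Lemma plug_limit g ss e qs : let n := g + 1 + length ss in
  plug g ss e qs = limit_e g n (plug_subst g ss e qs) n 0 (embed_e e).
Proof. reflexivity. Qed.

Section Plug.

Variables (G ss : list ty) (e : expr) (qs : nat -> proc).
Hypothesis typed_body : typed_p G (Lam (Arr ss :: ss) e) (Arr (Arr ss :: ss)).
Hypothesis typed_args : forall i t, nth_error ss i = Some t -> typed_p G (qs i) t.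

Definition plug_env : list entry :=
  id_env G ++ Rec (Clo (Lam (Arr ss :: ss) e) (id_env G))
    :: closures (length ss) qs (id_env G).

Lemma length_plug_env : length plug_env = length G + 1 + length ss.
Proof. unfold plug_env. rewrite length_app, length_vars. simpl. rewrite length_closures. lia. Qed.

Lemma typed_plug_env : typed_env G (G ++ Arr ss :: ss) plug_env.
Proof.
apply Forall2_app; [apply typed_id_env|]. constructor.
- constructor. econstructor; [exact typed_body | apply typed_id_env].
- exact (typed_closures typed_args (typed_id_env G)).
Qed.

Lemma assign_plug_env_free w : w < length G \/ length plug_env <= w ->
  assign plug_env (length plug_env) w = Var w.
Proof.
intros [Hw|Hw].
- apply assign_nth_error, nth_error_prefix, (nth_error_vars 0), Hw.
- rewrite assign_ge, Nat.sub_add by exact Hw. reflexivity.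
Qed.

Lemma plug_env_solves w d (n := length plug_env) : length G <= w < n -> n <= d ->
  exists P ts A e0 rho, plug_subst (length G) ss e qs w = STm P /\
    mren_p (shift n (d - n)) P = MLam ts A /\ unfolds_e (d + length ts) A e0 rho /\
    enters (assign plug_env n w) (vars d (length ts)) ts e0 (map (esub (assign plug_env n)) rho).
Proof.
unfold n. intros [Hw Hn] Hd. rewrite length_plug_env in *. unfold plug_subst.
rewrite (proj2 (Nat.ltb_ge _ _)) by exact Hw. destruct (Nat.eqb_spec w (length G)) as [->|Hne].
- do 5 eexists. split; [reflexivity|]. split; [apply mren_p_eq|]. split.
  + apply unfolds_e_lift; [exact Hd|].
    destruct (typed_Lam_inv typed_body) as [_ He]. apply unfolds_e_embed in He.
    rewrite length_app in He. simpl in He. rewrite <- Nat.add_succ_comm, <- Nat.add_1_r in He.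
    exact He.
  + rewrite <- length_plug_env. rewrite map_assign_vars_firstn by (rewrite length_plug_env; lia).
    rewrite (assign_nth_error (a := Rec (Clo (Lam (Arr ss :: ss) e) (id_env G)))).
    * unfold plug_env at 1. rewrite firstn_app, length_vars, firstn_all2
        by (rewrite length_vars; lia).
      replace (length G + 1 - length G) with 1 by lia. simpl.
      rewrite <- app_assoc. apply enters_Rec.
    * rewrite <- (Nat.add_0_r (length G)) at 1. apply nth_error_vars_app.
- set (i := w - length G - 1). assert (Hi : i < length ss) by lia.
  destruct (nth_error_exists ss _ Hi) as [t Ht]. pose proof (typed_args _ _ Ht) as Hq.
  assert (Ha : nth_error plug_env w = Some (Clo (qs i) (id_env G))).
  { replace w with (length G + S i) by lia. unfold plug_env. rewrite nth_error_vars_app.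
    apply nth_error_closures, Hi. }
  destruct (qs i) as [us b]. destruct (typed_Lam_inv Hq) as [-> Hb].
  apply unfolds_e_embed in Hb. rewrite length_app in Hb.
  do 5 eexists. split; [reflexivity|]. split; [rewrite embed_p_eq, !mren_p_eq; reflexivity|]. split.
  + rewrite <- Nat.add_assoc. apply unfolds_e_lift; [lia | exact Hb].
  + rewrite <- length_plug_env. rewrite map_assign_vars_firstn by (rewrite length_plug_env; lia).
    rewrite (assign_nth_error Ha). unfold plug_env.
    rewrite firstn_app, length_vars, Nat.sub_diag, firstn_all2, app_nil_r
      by (rewrite length_vars; lia).
    constructor.
Qed.

Lemma plug_result_nf_code : peq (plug_result (length G) ss e qs)
  (Lam [] (nf G (Call (Rec (Clo (Lam (Arr ss :: ss) e) (id_env G)))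
                      (closures (length ss) qs (id_env G)) []))).
Proof.
constructor. do 2 (erewrite nf_step by reflexivity). fold plug_env.
destruct (typed_Lam_inv typed_body) as [_ He].
assert (Hlen : length (G ++ Arr ss :: ss) = length G + 1 + length ss)
  by (rewrite length_app; simpl; lia).
rewrite <- (nf_strengthen G (Arr ss :: ss))
  by (econstructor; [exact He | exact typed_plug_env | constructor]).
rewrite <- length_app, Hlen. apply ren_e_eeq. rewrite <- Hlen at 1. apply nfe_nf.
- econstructor; [exact He | apply typed_env_weaken, typed_plug_env | constructor].
- constructor. rewrite Hlen, plug_limit, <- length_plug_env.
  rewrite <- (map_assign_vars plug_env (length plug_env)) at 4.
  apply unfolds_e_limit; [| | exact plug_env_solves | apply Nat.le_refl |].
  + exact assign_plug_env_free.
  + intros w Hw. unfold plug_subst. apply Nat.ltb_lt in Hw. rewrite Hw. reflexivity.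
  + rewrite length_plug_env, <- Hlen. exact (unfolds_e_embed _ _ He).
Qed.

End Plug.

Lemma plug_result_nf G ss e qs f bs (t := Arr (Arr ss :: ss)) :
  typed_entry G t f -> typed_env G ss bs -> peq (Lam (Arr ss :: ss) e) (nf_entry G t f) ->
  (forall i, i < length ss -> peq (qs i) (nf_entry G (nth i ss N) (nth i bs (Var 0)))) ->
  peq (plug_result (length G) ss e qs) (Lam [] (nf G (Call (Rec f) bs []))).
Proof.
intros Hf Hbs He Hqs. pose proof (sim_env_refl (typed_id_env G)) as Hid.
assert (Eid : forall w, w < length G -> assign (id_env G) 0 w = Var w)
  by (intros w; apply assign_vars).
rewrite plug_result_nf_code.
- constructor. apply sim_nf. econstructor; [| |constructor].
  + apply sim_Rec. rewrite <- (esub_id Hf Eid). exact (sim_Clo G G t _ f _ _ Hf He Hid).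
  + rewrite <- (map_esub_id Hbs Eid). exact (sim_closures G G _ _ ss bs qs Hid Hbs Hqs).
- exact (typed_peq _ _ _ _ (typed_nf_entry G t f Hf) (peq_sym _ _ He)).
- intros i u Hu. pose proof (nth_error_lt Hu) as Hi. rewrite <- (nth_error_nth _ _ N Hu).
  apply (typed_peq _ _ _ _ (typed_nf_entry G _ _ (Forall2_nth _ (Var 0) Hbs Hi))).
  symmetry. exact (Hqs i Hi).
Qed.

(** * Running interpreted terms *)

Lemma typed_ground_Case G x B : nth_error G x = Some N -> (forall i, typed_e G (B i)) ->
  typed_e G (Case x 0 dummy B).
Proof. intros Hx HB. apply (typed_Case _ _ []); auto. intros [|i] t Ht; discriminate. Qed.

Lemma nf_ground_Case D G rho x a B : typed_env D G rho -> nth_error G x = Some N ->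
  nth_error rho x = Some a -> (forall i, typed_e G (B i)) ->
  eeq (nf D (Eval (Case x 0 dummy B) rho []))
      (repl_e (fun i => nf D (Eval (B i) rho [])) (nf D (Call a [] []))).
Proof.
intros Hrho Hx Ha HB. destruct (Forall2_nth_error_l Hrho Hx) as (a' & Ha' & Hta).
rewrite Ha in Ha'. injection Ha' as <-.
rewrite (nf_step _ _ (Call a [] [(B, rho)])) by (simpl; rewrite Ha; reflexivity).
rewrite (nf_Call_stack D [] a [] [(B, rho)] Hta (Forall2_nil _))
  by (constructor; [exists G; auto | constructor]).
apply repl_e_eeq; [|reflexivity]. intros i. erewrite nf_step by reflexivity. reflexivity.
Qed.

Lemma nf_Eval_opt_num D o rho : eeq (nf D (Eval (opt_num o) rho [])) (opt_num o).
Proof.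
destruct o as [n|]; simpl; [rewrite nf_Eval_Num | rewrite nf_Eval_Bot]; reflexivity.
Qed.

Definition unary (g : nat) (f : nat -> option nat) : proc :=
  Lam [N] (Case g 0 dummy (fun i => opt_num (f i))).

Lemma typed_unary G f : typed_p G (unary (length G) f) (Arr [N]).
Proof.
constructor. apply typed_ground_Case; [apply nth_error_middle|].
intros i. destruct (f i); constructor.
Qed.

Lemma nf_Call_unary D G th f a : typed_env D G th -> typed_entry D N a ->
  eeq (nf D (Call (Clo (unary (length G) f) th) [a] []))
      (repl_e (fun i => opt_num (f i)) (nf D (Call a [] []))).
Proof.
intros Hth Ha. erewrite nf_step by reflexivity. rewrite (nf_ground_Case D (G ++ [N]) _ _ a).
- apply repl_e_eeq; [|reflexivity]. intros i. apply nf_Eval_opt_num.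
- apply Forall2_app; [exact Hth | constructor; [exact Ha | constructor]].
- apply nth_error_middle.
- rewrite (Forall2_length Hth). apply nth_error_middle.
- intros i. destruct (f i); constructor.
Qed.

Lemma typed_ifz G : typed_p G (interp G TIfz) (Arr [N; N; N]).
Proof.
constructor. apply typed_ground_Case; [apply nth_error_middle|].
intros [|i];
  (apply typed_ground_Case; [rewrite nth_error_app_add; reflexivity | intros; constructor]).
Qed.

Lemma repl_e_Num e h : (forall i, eeq (h i) (Num i)) -> eeq (repl_e h e) e.
Proof.
intros Hh. revert e. cofix IH. intros e. rewrite repl_e_eq. destruct e; [constructor | apply Hh |].
constructor; [intros i _; apply peq_refl | intros i; apply IH].
Qed.

Lemma nf_Call_ifz D G th a b c : typed_env D G th -> typed_env D [N; N; N] [a; b; c] ->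
  eeq (nf D (Call (Clo (interp G TIfz) th) [a; b; c] []))
      (repl_e (fun i => match i with
                        | 0 => nf D (Call b [] [])
                        | S _ => nf D (Call c [] [])
                        end) (nf D (Call a [] []))).
Proof.
intros Hth Habc. pose proof (Forall2_app Hth Habc) as Hrho. pose proof (Forall2_length Hth) as Hl.
assert (Hvar : forall j d, nth_error [N; N; N] j = Some N -> nth_error [a; b; c] j = Some d ->
  eeq (nf D (Eval (Case (length G + j) 0 dummy (fun i => Num i)) (th ++ [a; b; c]) []))
      (nf D (Call d [] []))).
{ intros j d Hj Hd.
  rewrite (nf_ground_Case D (G ++ [N; N; N]) _ _ d _ Hrho);
    [| rewrite nth_error_app_add; exact Hj
     | rewrite Hl, nth_error_app_add; exact Hd
     | intros; constructor].
  apply repl_e_Num. intros i. exact (nf_Eval_opt_num D (Some i) _). }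
erewrite nf_step by reflexivity. rewrite (nf_ground_Case D (G ++ [N; N; N]) _ _ a _ Hrho).
- apply repl_e_eeq; [|reflexivity].
  intros [|i]; [apply (Hvar 1) | apply (Hvar 2)]; reflexivity.
- apply nth_error_middle.
- rewrite Hl. apply nth_error_middle.
- intros [|i];
    (apply typed_ground_Case; [rewrite nth_error_app_add; reflexivity | intros; constructor]).
Qed.

Lemma typed_eta G x t : nth_error G x = Some t -> typed_p G (eta (length G) x t) t.
Proof.
intros Hx. apply (typed_peq _ (nf_entry G t (Var x))).
- apply typed_nf_entry. constructor. exact Hx.
- symmetry. apply eta_nf_entry, Hx.
Qed.

Lemma nf_Call_eta D G th x ts a bs : typed_env D G th -> nth_error G x = Some (Arr ts) ->
  nth_error th x = Some a -> typed_env D ts bs ->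
  eeq (nf D (Call (Clo (eta (length G) x (Arr ts)) th) bs [])) (nf D (Call a bs [])).
Proof.
intros Hth Hx Ha Hbs. rewrite <- (assign_nth_error (n := 0) Ha).
change (assign th 0 x) with (esub (assign th 0) (Var x)).
apply (nf_Call_nf D G _ _ ts); auto using eta_nf_entry. constructor. exact Hx.
Qed.

Lemma typed_app G p q t ts : typed_p G p (Arr (t :: ts)) -> typed_p G q t ->
  typed_p G (Defs.app (length G) p q) (Arr ts).
Proof.
intros Hp Hq. eapply typed_peq; [|symmetry; exact (app_nf G p q t ts Hp Hq)].
constructor. apply typed_nf, (typed_Call_id Hp Hq).
Qed.

Lemma nf_Call_app D G p q t ts th bs : typed_p G p (Arr (t :: ts)) -> typed_p G q t ->
  typed_env D G th -> typed_env D ts bs ->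
  eeq (nf D (Call (Clo (Defs.app (length G) p q) th) bs []))
      (nf D (Call (Clo p th) (Clo q th :: bs) [])).
Proof.
intros Hp Hq Hth Hbs. pose proof (peq_sym _ _ (app_nf G p q t ts Hp Hq)) as He.
apply peq_inv in He. destruct He as (e & -> & He).
set (s := Call _ _ _) in He.
erewrite nf_step by reflexivity.
rewrite (nf_Eval_nf D (G ++ ts) e s).
- unfold s. simpl. pose proof (map_assign_vars_app th bs 0) as [E1 E2].
  rewrite (Forall2_length Hth), (Forall2_length Hbs), E1, E2. reflexivity.
- exact (typed_Call_id Hp Hq).
- symmetry. exact He.
- exact (Forall2_app Hth Hbs).
- constructor.
Qed.

Lemma interp_Y G ss (t := Arr (Arr ss :: ss)) : exists e,
  interp G (TY (Arr ss)) = Lam (t :: ss) e /\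
  eeq e (nf ((G ++ [t]) ++ ss) (Call (Rec (Var (length G))) (fresh (G ++ [t]) ss) [])).
Proof.
pose proof (Fy_nf_entry (G ++ [t]) (length G) ss (nth_error_middle _ _ _)) as HF.
rewrite nf_entry_eq in HF. apply peq_sym, peq_inv in HF. destruct HF as (e & HF & He).
exists e. split; [|symmetry; exact He]. rewrite (length_app G [t] : _ = length G + 1) in HF.
transitivity (match Fy (length G + 1) (length G) ss with Lam _ e => Lam (t :: ss) e end);
  [reflexivity | rewrite HF; reflexivity].
Qed.

Lemma typed_Y_body G ss (t := Arr (Arr ss :: ss)) : typed_state ((G ++ [t]) ++ ss)
  (Call (Rec (Var (length G))) (fresh (G ++ [t]) ss) []).
Proof.
econstructor; [| apply typed_fresh | constructor].
apply typed_entry_weaken. constructor. constructor. apply nth_error_middle.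
Qed.

Lemma nf_Call_Y D G ss th f bs : typed_env D G th -> typed_entry D (Arr (Arr ss :: ss)) f ->
  typed_env D ss bs ->
  eeq (nf D (Call (Clo (interp G (TY (Arr ss))) th) (f :: bs) [])) (nf D (Call (Rec f) bs [])).
Proof.
intros Hth Hf Hbs. destruct (interp_Y G ss) as (e & -> & He). set (t := Arr (Arr ss :: ss)) in *.
assert (Hth' : typed_env D (G ++ [t]) (th ++ [f]))
  by (apply Forall2_app; [exact Hth | constructor; [exact Hf | constructor]]).
erewrite nf_step by reflexivity.
replace (th ++ f :: bs) with ((th ++ [f]) ++ bs) by (rewrite <- app_assoc; reflexivity).
rewrite (nf_Eval_nf D ((G ++ [t]) ++ ss) e _ _ [] (typed_Y_body G ss) He (Forall2_app Hth' Hbs)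
  (typed_stack_nil D)).
fold t. rewrite (Forall2_length Hth'), (Forall2_length Hbs). simpl.
rewrite (proj2 (map_assign_vars_app (th ++ [f]) bs 0)), (assign_nth_error (a := f)); [reflexivity|].
apply nth_error_prefix. rewrite (Forall2_length Hth). apply nth_error_middle.
Qed.

Lemma typed_interp [k G M t] : has_type k G M t -> typed_p G (interp G M) t.
Proof.
induction 1 as [G v Hv | G s M t _ IH | G M M' s ts _ IH1 _ IH2
  | G n | G | G | G | G [ss] Hs | G f].
- apply typed_eta, nth_error_nth', Hv.
- simpl. destruct (interp (G ++ [s]) M) as [ts e]. destruct (typed_Lam_inv IH) as [-> He].
  constructor. rewrite <- app_assoc in He. exact He.
- exact (typed_app G _ _ s ts IH1 IH2).
- constructor. constructor.
- exact (typed_unary G (fun i => Some (S i))).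
- exact (typed_unary G (fun i => Some (pred i))).
- apply typed_ifz.
- destruct (interp_Y G ss) as (e & -> & He). constructor.
  replace (G ++ _) with ((G ++ [Arr (Arr ss :: ss)]) ++ ss) by (rewrite <- app_assoc; reflexivity).
  apply (typed_eeq _ _ _ (typed_nf _ _ (typed_Y_body G ss)) (eeq_sym _ _ He)).
- exact (typed_unary G f).
Qed.

(** * Denotable procedures are generated *)

Lemma gen_peq k G p p' : gen k G p -> peq p' p -> gen k G p'.
Proof.
intros [G0 x ts qs q Hx Hn Hq Hp | G0 s q q' Hq Hp | G0 n q Hp | G0 q f q' Hq Hp
  | G0 ts e d e' q' He Hd He' Hp | G0 ss e qs q' Hl He Hq Hp] Hpp;
  pose proof (peq_trans _ _ _ Hpp Hp) as H.
- exact (gen_var k G0 x ts qs p' Hx Hn Hq H).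
- exact (gen_lam k G0 s q p' Hq H).
- exact (gen_num k G0 n p' H).
- exact (gen_fun k G0 q f p' Hq H).
- exact (gen_ifz k G0 ts e d e' p' He Hd He' H).
- exact (gen_plug k G0 ss e qs p' Hl He Hq H).
Qed.

Lemma gen_ground k G e e' : gen k G (Lam [] e) -> eeq e' e -> gen k G (Lam [] e').
Proof. intros H He. apply (gen_peq k G _ _ H). constructor. exact He. Qed.

Lemma gen_lams k G ts us e : gen k (G ++ ts) (Lam us e) -> gen k G (Lam (ts ++ us) e).
Proof.
revert G. induction ts as [|s ts IH]; intros G H; simpl.
- rewrite app_nil_r in H. exact H.
- eapply gen_lam; [apply IH; rewrite <- app_assoc; exact H | apply peq_refl].
Qed.

(* Tait's computability predicate; quantifying over the extensions [D'] of the context makes it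
   stable under weakening. *)
Fixpoint computable (k : nat) (t : ty) (D : list ty) (a : entry) {struct t} : Prop :=
  match t with
  | Arr ts =>
      typed_entry D (Arr ts) a /\
      forall D' bs,
        Forall2 (fun C b => C b) (map (fun u => computable k u (D ++ D')) ts) bs ->
        gen k (D ++ D') (Lam [] (nf (D ++ D') (Call a bs [])))
  end.

Definition computable_env (k : nat) (D ts : list ty) (bs : list entry) : Prop :=
  Forall2 (fun t => computable k t D) ts bs.

Definition computable_code (k : nat) (G : list ty) (p : proc) (t : ty) : Prop :=
  forall D th, computable_env k D G th -> computable k t D (Clo p th).

Lemma computable_Arr k ts D a : computable k (Arr ts) D a <->
  typed_entry D (Arr ts) a /\
  forall D' bs, computable_env k (D ++ D') ts bs ->
    gen k (D ++ D') (Lam [] (nf (D ++ D') (Call a bs []))).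
Proof.
split; intros [Ha H]; (split; [exact Ha | intros D' bs Hbs; apply H]); revert Hbs;
  apply (Forall2_map_l (fun C b => C b) (fun u => computable k u (D ++ D'))).
Qed.

Arguments computable : simpl never.

Lemma computable_typed [k t D a] : computable k t D a -> typed_entry D t a.
Proof. destruct t. intros H. apply computable_Arr in H. apply H. Qed.

Lemma computable_env_typed [k D ts bs] : computable_env k D ts bs -> typed_env D ts bs.
Proof. apply Forall2_impl. intros t a. apply computable_typed. Qed.

Lemma computable_Call [k ts D a bs] : computable k (Arr ts) D a -> computable_env k D ts bs ->
  gen k D (Lam [] (nf D (Call a bs []))).
Proof.
intros Ha Hbs. apply computable_Arr in Ha. destruct Ha as [_ Ha].
specialize (Ha [] bs). rewrite app_nil_r in Ha. exact (Ha Hbs).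
Qed.

Lemma computable_weaken k t D D' a : computable k t D a -> computable k t (D ++ D') a.
Proof.
destruct t as [ts]. rewrite !computable_Arr. intros [Ht H].
split; [apply typed_entry_weaken, Ht|]. intros D1 bs. rewrite <- app_assoc. apply H.
Qed.

Lemma computable_env_weaken k D D' ts bs :
  computable_env k D ts bs -> computable_env k (D ++ D') ts bs.
Proof. apply Forall2_impl. intros t a. apply computable_weaken. Qed.

Lemma computable_code_intro k G p ts : typed_p G p (Arr ts) ->
  (forall D th bs, computable_env k D G th -> computable_env k D ts bs ->
     gen k D (Lam [] (nf D (Call (Clo p th) bs [])))) ->
  computable_code k G p (Arr ts).
Proof.
intros Hp H D th Hth. apply computable_Arr. split.
- econstructor; [exact Hp | exact (computable_env_typed Hth)].
- intros D' bs Hbs. apply H; [apply computable_env_weaken, Hth | exact Hbs].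
Qed.

Lemma ty_ind_nested (P : ty -> Prop) :
  (forall ts, (forall t, In t ts -> P t) -> P (Arr ts)) -> forall t, P t.
Proof.
intros H. fix IH 1. intros [ts]. apply H. induction ts as [|t ts IHts]; [intros _ []|].
intros u [<- | Hu]; [apply IH | exact (IHts u Hu)].
Qed.

(* Reification at a type needs reflection at the argument types, and conversely. *)
Lemma reflect_reify k t :
  (forall D w, nth_error D w = Some t -> computable k t D (Var w)) /\
  (forall D a, computable k t D a -> gen k D (nf_entry D t a)).
Proof.
induction t as [ts IH] using ty_ind_nested. split.
- intros D w Hw. apply computable_Arr. split; [constructor; exact Hw|]. intros D' bs Hbs.
  pose proof (nth_error_prefix (l' := D') Hw) as Hw'. rewrite (nf_Call_Var Hw').
  apply (gen_var k (D ++ D') w ts (fun i => nf_entry (D ++ D') (nth i ts N) (nth i bs (Var 0)))).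
  + exact (nth_error_lt Hw').
  + apply nth_error_nth, Hw'.
  + intros i Hi. split; [|apply ptype_nf_entry].
    apply IH; [apply nth_In, Hi | exact (Forall2_nth _ _ Hbs Hi)].
  + constructor. constructor; [reflexivity|]. intros i. rewrite nf_Ret_nil. reflexivity.
- intros D a Ha. rewrite nf_entry_eq. rewrite <- (app_nil_r ts) at 1. apply gen_lams.
  apply (computable_Call (ts := ts)); [apply computable_weaken, Ha|].
  apply Forall2_map_seq. intros i u Hu. apply IH; [exact (nth_error_In _ _ Hu)|].
  rewrite nth_error_app_add. exact Hu.
Qed.

Lemma computable_Var k t D w : nth_error D w = Some t -> computable k t D (Var w).
Proof. apply reflect_reify. Qed.

Lemma gen_nf_entry [k t D a] : computable k t D a -> gen k D (nf_entry D t a).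
Proof. apply reflect_reify. Qed.

Lemma computable_id_env k G : computable_env k G G (id_env G).
Proof. apply Forall2_map_seq. intros i u Hu. apply computable_Var, Hu. Qed.

Lemma computable_eta k G x t : nth_error G x = Some t -> computable_code k G (eta (length G) x t) t.
Proof.
destruct t as [ts]. intros Hx. apply computable_code_intro; [apply typed_eta, Hx|].
intros D th bs Hth Hbs. destruct (Forall2_nth_error_l Hth Hx) as (a & Ha & Hca).
eapply gen_ground; [exact (computable_Call Hca Hbs)|].
apply nf_Call_eta; eauto using computable_env_typed.
Qed.

Lemma computable_lam k G s p t : typed_p (G ++ [s]) p t -> computable_code k (G ++ [s]) p t ->
  computable_code k G (lam1 s p) (arrow s t).
Proof.
intros Hp H. destruct p as [ts e]. destruct (typed_Lam_inv Hp) as [-> He].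
rewrite <- app_assoc in He. apply computable_code_intro; [constructor; exact He|].
intros D th bs Hth Hbs. inversion Hbs as [|u b us bs' Hb Hbs']; subst.
assert (Hth' : computable_env k D (G ++ [s]) (th ++ [b]))
  by (apply Forall2_app; [exact Hth | constructor; [exact Hb | constructor]]).
pose proof (computable_Call (H D _ Hth') Hbs') as Hgen.
erewrite nf_step in Hgen by reflexivity. rewrite <- app_assoc in Hgen.
erewrite nf_step by reflexivity. exact Hgen.
Qed.

Lemma computable_app k G p q s ts : typed_p G p (Arr (s :: ts)) -> typed_p G q s ->
  computable_code k G p (Arr (s :: ts)) -> computable_code k G q s ->
  computable_code k G (Defs.app (length G) p q) (Arr ts).
Proof.
intros Hp Hq Hcp Hcq. apply computable_code_intro; [exact (typed_app G p q s ts Hp Hq)|].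
intros D th bs Hth Hbs.
eapply gen_ground; [|apply (nf_Call_app D G p q s ts); eauto using computable_env_typed].
apply (computable_Call (ts := s :: ts)); [apply Hcp, Hth|].
constructor; [apply Hcq, Hth | exact Hbs].
Qed.

Lemma computable_num k G n : computable_code k G (Lam [] (Num n)) N.
Proof.
apply computable_code_intro; [constructor; constructor|]. intros D th bs _ _.
do 2 (erewrite nf_step by reflexivity). rewrite nf_Ret_nil. eapply gen_num. reflexivity.
Qed.

Lemma computable_unary k G f : computable_code k G (unary (length G) f) (Arr [N]).
Proof.
apply computable_code_intro; [apply typed_unary|]. intros D th bs Hth Hbs.
inversion Hbs as [|t a ts bs' Ha Hnil]; subst. inversion Hnil; subst.
apply (gen_fun k D (Lam [] (nf D (Call a [] []))) f);
  [exact (computable_Call Ha (Forall2_nil _))|].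
constructor.
apply nf_Call_unary; [exact (computable_env_typed Hth) | exact (computable_typed Ha)].
Qed.

Lemma computable_ifz k G : computable_code k G (interp G TIfz) (Arr [N; N; N]).
Proof.
apply computable_code_intro; [apply typed_ifz|]. intros D th bs Hth Hbs.
pose proof (computable_env_typed Hbs) as Htbs.
inversion Hbs as [|t1 a ts1 bs1 Ha Hbs1]; subst. inversion Hbs1 as [|t2 b ts2 bs2 Hb Hbs2]; subst.
inversion Hbs2 as [|t3 c ts3 bs3 Hc Hbs3]; subst. inversion Hbs3; subst.
assert (Hgen : forall d, computable k N D d -> gen k D (Lam [] (nf D (Call d [] []))))
  by (intros d Hd; exact (computable_Call Hd (Forall2_nil _))).
apply (gen_ifz k D [] _ _ _ _ (Hgen a Ha) (Hgen b Hb) (Hgen c Hc)). constructor.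
rewrite (nf_Call_ifz D G th a b c (computable_env_typed Hth) Htbs).
apply repl_e_eeq; [|reflexivity]. intros [|i]; symmetry; apply ren_e_id; apply shift_0.
Qed.

Lemma computable_Y k G ss (t := Arr ss) : lv t <= k ->
  computable_code k G (interp G (TY t)) (arrow (arrow t t) t).
Proof.
intros Hlv. apply computable_code_intro; [exact (typed_interp (ht_Y k G t Hlv))|].
intros D th bs0 Hth Hbs0. inversion Hbs0 as [|t0 f ts0 bs Hf Hbs]; subst.
pose proof (computable_typed Hf) as Htf. pose proof (computable_env_typed Hbs) as Htbs.
pose proof (gen_nf_entry Hf) as Hgf. rewrite nf_entry_eq in Hgf.
set (e := nf _ _) in Hgf. set (qs := fun i => nf_entry D (nth i ss N) (nth i bs (Var 0))).
apply (gen_plug k D ss e qs _ Hlv Hgf).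
- intros i Hi. split; [|apply ptype_nf_entry].
  exact (gen_nf_entry (Forall2_nth _ _ Hbs Hi)).
- rewrite (plug_result_nf D ss e qs f bs Htf Htbs);
    [|rewrite nf_entry_eq; reflexivity | reflexivity].
  constructor. apply nf_Call_Y; [exact (computable_env_typed Hth) | exact Htf | exact Htbs].
Qed.

Lemma computable_interp k G M t : has_type k G M t -> computable_code k G (interp G M) t.
Proof.
induction 1 as [G v Hv | G s M t HM IH | G M M' s ts HM IH HM' IH'
  | G n | G | G | G | G [ss] Hs | G f].
- apply computable_eta, nth_error_nth', Hv.
- exact (computable_lam k G s _ t (typed_interp HM) IH).
- exact (computable_app k G _ _ s ts (typed_interp HM) (typed_interp HM') IH IH').
- apply computable_num.
- exact (computable_unary k G (fun i => Some (S i))).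
- exact (computable_unary k G (fun i => Some (pred i))).
- apply computable_ifz.
- apply computable_Y, Hs.
- exact (computable_unary k G f).
Qed.

Lemma gen_interp k G M t : has_type k G M t -> gen k G (interp G M).
Proof.
intros HM. eapply gen_peq.
- apply gen_nf_entry. exact (computable_interp k G M t HM G _ (computable_id_env k G)).
- symmetry. apply nf_entry_Clo_id, (typed_interp HM).
Qed.

(** * Generated procedures are denotable *)

Definition apps (M : term) (Ms : list term) : term := fold_left TApp Ms M.
Definition lams (ts : list ty) (M : term) : term := fold_right TLam M ts.
Definition tvars (d k : nat) : list term := map TVar (seq d k).

Definition args (G : list ty) (th : list entry) (Ms : list term) : list entry :=
  map (fun M => Clo (interp G M) th) Ms.

Definition typed_terms (k : nat) (G ts : list ty) (Ms : list term) : Prop :=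
  Forall2 (fun t M => has_type k G M t) ts Ms.

Lemma has_type_Var k G x t : nth_error G x = Some t -> has_type k G (TVar x) t.
Proof.
intros Hx. rewrite <- (nth_error_nth _ _ N Hx). constructor. exact (nth_error_lt Hx).
Qed.

Lemma has_type_apps [k G Ms ss] : typed_terms k G ss Ms ->
  forall M us, has_type k G M (Arr (ss ++ us)) -> has_type k G (apps M Ms) (Arr us).
Proof.
induction 1 as [|s M' ss Ms HM' _ IH]; intros M us HM; [exact HM|].
apply IH. econstructor; eauto.
Qed.

Lemma has_type_lams k ts : forall G M us, has_type k (G ++ ts) M (Arr us) ->
  has_type k G (lams ts M) (Arr (ts ++ us)).
Proof.
induction ts as [|s ts IH]; intros G M us HM; simpl.
- rewrite app_nil_r in HM. exact HM.
- apply (ht_lam k G s (lams ts M) (Arr (ts ++ us))). apply IH. rewrite <- app_assoc. exact HM.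
Qed.

Lemma interp_lams ts : forall G M us e, interp (G ++ ts) M = Lam us e ->
  interp G (lams ts M) = Lam (ts ++ us) e.
Proof.
induction ts as [|s ts IH]; intros G M us e HM; simpl.
- rewrite app_nil_r in HM. exact HM.
- rewrite (IH (G ++ [s]) M us e); [reflexivity|]. rewrite <- app_assoc. exact HM.
Qed.

Lemma typed_interp_args [k D G th Ms ss] : typed_terms k G ss Ms -> typed_env D G th ->
  typed_env D ss (args G th Ms).
Proof.
intros HMs Hth. induction HMs as [|s M ss Ms HM _ IH]; constructor; [|exact IH].
econstructor; [exact (typed_interp HM) | exact Hth].
Qed.

Lemma nf_Call_apps [k D G th us bs Ms ss] : typed_terms k G ss Ms ->
  typed_env D G th -> typed_env D us bs -> forall M, has_type k G M (Arr (ss ++ us)) ->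
  eeq (nf D (Call (Clo (interp G (apps M Ms)) th) bs []))
      (nf D (Call (Clo (interp G M) th) (args G th Ms ++ bs) [])).
Proof.
intros HMs Hth Hbs. induction HMs as [|s M' ss Ms HM' HMs IH]; intros M HM; [reflexivity|].
simpl apps. rewrite (IH (TApp M M')) by (econstructor; eauto).
apply (nf_Call_app D G _ _ s (ss ++ us)); eauto using typed_interp.
exact (Forall2_app (typed_interp_args HMs Hth) Hbs).
Qed.

Lemma nf_Call_lams k D G th bs ts M : has_type k (G ++ ts) M N ->
  nf D (Call (Clo (interp G (lams ts M)) th) bs []) =
  nf D (Call (Clo (interp (G ++ ts) M) (th ++ bs)) [] []).
Proof.
intros HM. pose proof (typed_interp HM) as Hp.
destruct (interp (G ++ ts) M) as [us e] eqn:E. apply typed_ptype in Hp. injection Hp as ->.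
rewrite (interp_lams ts G M [] e E). transitivity (nf D (Eval e (th ++ bs) [])).
- apply nf_step. reflexivity.
- rewrite <- (app_nil_r (th ++ bs)) at 1. symmetry. apply nf_step. reflexivity.
Qed.

Lemma denotable_peq k G p p' : denotable k G p -> peq p' p -> denotable k G p'.
Proof. intros (M & t & HM & Hp) H. exists M, t. split; [exact HM | rewrite H; exact Hp]. Qed.

Lemma denotable_nf_entry k G p : denotable k G p <->
  exists M, has_type k G M (ptype p) /\
    peq p (nf_entry G (ptype p) (Clo (interp G M) (id_env G))).
Proof.
split.
- intros (M & t & HM & Hp). pose proof (typed_interp HM) as Ht.
  rewrite (typed_ptype (typed_peq _ _ _ _ Ht (peq_sym _ _ Hp))).
  exists M. split; [exact HM|]. rewrite Hp. symmetry. apply nf_entry_Clo_id, Ht.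
- intros (M & HM & Hp). exists M, (ptype p). split; [exact HM|].
  rewrite Hp at 1. apply nf_entry_Clo_id, (typed_interp HM).
Qed.

Lemma denotable_Lam k G ts e : denotable k G (Lam ts e) <->
  exists M, has_type k G M (Arr ts) /\
    eeq e (nf (G ++ ts) (Call (Clo (interp G M) (id_env G)) (fresh G ts) [])).
Proof.
rewrite denotable_nf_entry. simpl ptype. split; intros (M & HM & Hp); exists M;
  (split; [exact HM|]); rewrite nf_entry_eq in *.
- apply peq_Lam_inv in Hp. apply Hp.
- constructor. exact Hp.
Qed.

Lemma denotable_ground k G e : denotable k G (Lam [] e) <->
  exists M, has_type k G M N /\ eeq e (nf G (Call (Clo (interp G M) (id_env G)) [] [])).
Proof. rewrite denotable_Lam, app_nil_r. reflexivity. Qed.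

Lemma denotable_args [k G qs ss] :
  (forall i, i < length ss -> denotable k G (qs i) /\ ptype (qs i) = nth i ss N) ->
  exists Ms, typed_terms k G ss Ms /\ forall i, i < length ss ->
    peq (qs i) (nf_entry G (nth i ss N) (nth i (args G (id_env G) Ms) (Var 0))).
Proof.
revert qs. induction ss as [|s ss IH]; intros qs Hqs.
- exists []. split; [constructor | intros i Hi; inversion Hi].
- destruct (IH (fun i => qs (S i))) as (Ms & HMs & Hpeq).
  { intros i Hi. apply (Hqs (S i)). simpl. lia. }
  destruct (Hqs 0) as [H0 Ht]; [simpl; lia|]. apply denotable_nf_entry in H0.
  destruct H0 as (M & HM & HqM). rewrite Ht in HM, HqM.
  exists (M :: Ms). split; [constructor; assumption|].
  intros [|i] Hi; [exact HqM | apply Hpeq; simpl in Hi; lia].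
Qed.

Lemma denotable_var k G x ts qs : x < length G -> nth x G N = Arr ts ->
  (forall i, i < length ts -> denotable k G (qs i) /\ ptype (qs i) = nth i ts N) ->
  denotable k G (Lam [] (Case x (length ts) qs (fun j => Num j))).
Proof.
intros Hx Hn Hqs. destruct (denotable_args Hqs) as (Ms & HMs & Hpeq).
pose proof (nth_error_nth' G N Hx) as Hx'. rewrite Hn in Hx'. pose proof (typed_id_env G) as Hid.
assert (HM : has_type k G (TVar x) (Arr (ts ++ [])))
  by (rewrite app_nil_r; apply has_type_Var, Hx').
apply denotable_ground. exists (apps (TVar x) Ms).
split; [exact (has_type_apps HMs _ _ HM)|].
rewrite (nf_Call_apps HMs Hid (Forall2_nil _) _ HM), app_nil_r.
simpl interp. rewrite Hn.
rewrite (nf_Call_eta G G _ x ts (Var x));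
  [| exact Hid | exact Hx' | apply (nth_error_vars 0), Hx |].
- rewrite (nf_Call_Var Hx'). constructor; [exact Hpeq|].
  intros i. rewrite nf_Ret_nil. constructor.
- exact (typed_interp_args HMs Hid).
Qed.

Lemma denotable_lam k G s p : denotable k (G ++ [s]) p -> denotable k G (lam1 s p).
Proof.
intros (M & t & HM & Hp). exists (TLam s M), (arrow s t). split; [constructor; exact HM|].
simpl. destruct Hp. constructor. assumption.
Qed.

Lemma denotable_plug k G ss e qs : lv (Arr ss) <= k ->
  denotable k G (Lam (Arr ss :: ss) e) ->
  (forall i, i < length ss -> denotable k G (qs i) /\ ptype (qs i) = nth i ss N) ->
  denotable k G (plug_result (length G) ss e qs).
Proof.
intros Hlv He Hqs. destruct (denotable_args Hqs) as (Ms & HMs & Hpeq).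
apply denotable_nf_entry in He. destruct He as (M & HM & HpM). simpl ptype in HM, HpM.
pose proof (typed_id_env G) as Hid. set (id := id_env G) in *.
set (f := Clo (interp G M) id) in *.
assert (Hf : typed_entry G (Arr (Arr ss :: ss)) f)
  by (econstructor; [exact (typed_interp HM) | exact Hid]).
pose proof (typed_interp_args HMs Hid) as Hargs.
apply (denotable_peq k G (Lam [] (nf G (Call (Rec f) (args G id Ms) []))));
  [|exact (plug_result_nf G ss e qs f _ Hf Hargs HpM Hpeq)].
assert (HY : has_type k G (TY (Arr ss)) (Arr ((Arr (Arr ss :: ss) :: ss) ++ [])))
  by (rewrite app_nil_r; apply (ht_Y k G (Arr ss)), Hlv).
assert (HMs' : typed_terms k G (Arr (Arr ss :: ss) :: ss) (M :: Ms)) by (constructor; assumption).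
apply denotable_ground. exists (apps (TY (Arr ss)) (M :: Ms)).
split; [exact (has_type_apps HMs' _ _ HY)|].
fold id. rewrite (nf_Call_apps HMs' Hid (Forall2_nil _) _ HY), app_nil_r.
symmetry. exact (nf_Call_Y G G ss id f _ Hid Hf Hargs).
Qed.

Lemma typed_tvars k G ts : typed_terms k (G ++ ts) ts (tvars (length G) (length ts)).
Proof.
apply Forall2_map_seq. intros i t Ht. apply has_type_Var. rewrite nth_error_app_add. exact Ht.
Qed.

Lemma sim_args_tvars D G ts rho bs : typed_env D (G ++ ts) (rho ++ bs) -> length bs = length ts ->
  sim_env D ts (args (G ++ ts) (rho ++ bs) (tvars (length G) (length ts))) bs.
Proof.
intros Henv Hl. assert (Hl' : length rho = length G).
{ pose proof (Forall2_length Henv) as E. rewrite !length_app in E. lia. }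
pose proof (sim_closures D (G ++ ts) (rho ++ bs) (rho ++ bs) ts (fresh G ts)
  (fun i => interp (G ++ ts) (TVar (length G + i))) (sim_env_refl Henv) (typed_fresh G ts)) as H.
rewrite <- Hl', <- Hl, (proj2 (map_assign_vars_app rho bs 0)) in H. rewrite <- Hl', <- Hl.
unfold args, tvars. rewrite map_map, map_seq_shift. apply H. rewrite Hl', Hl. intros i Hi. clear H.
rewrite nth_vars by exact Hi.
assert (Hx : nth_error (G ++ ts) (length G + i) = Some (nth i ts N))
  by (rewrite nth_error_app_add; apply nth_error_nth', Hi).
simpl. rewrite (nth_error_nth _ _ _ Hx). apply eta_nf_entry, Hx.
Qed.

(* The denoted terms [Ms] are passed as arguments [As] to an abstraction over [As ++ ts], which
   avoids having to weaken them under the binders [ts]. *)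
Section Combinators.

Variables (k : nat) (G As ts : list ty) (Ms : list term).
Hypothesis typed_Ms : typed_terms k G As Ms.

Definition combinator_env : list entry :=
  id_env G ++ args G (id_env G) Ms ++ fresh G ts.

Lemma typed_combinator_env : typed_env (G ++ ts) (G ++ As ++ ts) combinator_env.
Proof.
apply Forall2_app; [apply typed_env_weaken, typed_id_env|].
apply Forall2_app; [apply typed_env_weaken | apply typed_fresh].
exact (typed_interp_args typed_Ms (typed_id_env G)).
Qed.

Lemma denotable_combinator M e : has_type k (G ++ As ++ ts) M N ->
  eeq e (nf (G ++ ts) (Call (Clo (interp (G ++ As ++ ts) M) combinator_env) [] [])) ->
  denotable k G (Lam ts e).
Proof.
intros HM He. apply denotable_Lam. exists (apps (lams (As ++ ts) M) Ms).
assert (HL : has_type k G (lams (As ++ ts) M) (Arr (As ++ ts))).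
{ rewrite <- (app_nil_r (As ++ ts)) at 2. apply has_type_lams. exact HM. }
split; [exact (has_type_apps typed_Ms _ _ HL)|].
rewrite (nf_Call_apps typed_Ms (typed_env_weaken (typed_id_env G)) (typed_fresh G ts) _ HL).
rewrite (nf_Call_lams k) by exact HM. exact He.
Qed.

Lemma nf_Call_combinator_param i M us bs :
  nth_error Ms i = Some M -> nth_error As i = Some (Arr us) -> typed_env (G ++ ts) us bs ->
  eeq (nf (G ++ ts)
        (Call (Clo (interp (G ++ As ++ ts) (TVar (length G + i))) combinator_env) bs []))
      (nf (G ++ ts) (Call (Clo (interp G M) (id_env G)) bs [])).
Proof.
intros HM HA Hbs.
assert (Hx : nth_error (G ++ As ++ ts) (length G + i) = Some (Arr us))
  by (rewrite nth_error_app_add; apply nth_error_prefix, HA).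
simpl interp. rewrite (nth_error_nth _ _ N Hx).
apply nf_Call_eta; [exact typed_combinator_env | exact Hx | | exact Hbs].
unfold combinator_env. rewrite nth_error_vars_app. apply nth_error_prefix.
unfold args. rewrite nth_error_map, HM. reflexivity.
Qed.

Lemma nf_Call_combinator_head i M : nth_error Ms i = Some M -> nth_error As i = Some (Arr ts) ->
  let X := apps (TVar (length G + i)) (tvars (length (G ++ As)) (length ts)) in
  has_type k (G ++ As ++ ts) X N /\
  eeq (nf (G ++ ts) (Call (Clo (interp (G ++ As ++ ts) X) combinator_env) [] []))
      (nf (G ++ ts) (Call (Clo (interp G M) (id_env G)) (fresh G ts) [])).
Proof.
intros HM HA X. pose proof (typed_tvars k (G ++ As) ts) as Hvars. rewrite <- app_assoc in Hvars.
assert (Hx : has_type k (G ++ As ++ ts) (TVar (length G + i)) (Arr (ts ++ []))).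
{ rewrite app_nil_r. apply has_type_Var. rewrite nth_error_app_add. apply nth_error_prefix, HA. }
split; [exact (has_type_apps Hvars _ _ Hx)|].
pose proof (typed_interp_args Hvars typed_combinator_env) as Hargs. unfold X.
rewrite (nf_Call_apps Hvars typed_combinator_env (Forall2_nil _) _ Hx), app_nil_r.
rewrite (nf_Call_combinator_param i M ts _ HM HA Hargs).
apply sim_nf, (sim_Call _ ts); [apply sim_entry_refl | | constructor].
- econstructor; [|apply typed_env_weaken, typed_id_env].
  destruct (Forall2_nth_error_l typed_Ms HA) as (M' & HM' & Ht).
  rewrite HM in HM'. injection HM' as <-. exact (typed_interp Ht).
- pose proof typed_combinator_env as Henv. unfold combinator_env in *. rewrite !app_assoc in *.
  apply sim_args_tvars; [exact Henv | apply length_vars].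
Qed.

End Combinators.

Lemma denotable_fun k G p f : denotable k G p ->
  denotable k G (repl_p (fun i => opt_num (f i)) p).
Proof.
destruct p as [ts e]. intros He. apply denotable_Lam in He. destruct He as (M & HM & He).
assert (HMs : typed_terms k G [Arr ts] [M]) by (constructor; [exact HM | constructor]).
destruct (nf_Call_combinator_head k G [Arr ts] ts [M] HMs 0 M eq_refl eq_refl) as [HX HeX].
set (G' := G ++ [Arr ts] ++ ts) in *. set (X := apps _ _) in *.
pose proof (typed_combinator_env k G [Arr ts] ts [M] HMs) as Henv. fold G' in Henv.
apply (denotable_combinator k G [Arr ts] ts [M] HMs (TApp (TC f) X)).
{ econstructor; [constructor | exact HX]. }
fold G'. pose proof (typed_interp HX) as HpX.
simpl interp. change (Lam [N] _) with (unary (length G') f).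
rewrite (nf_Call_app _ G' _ _ N [] _ [] (typed_unary G' f) HpX Henv (Forall2_nil _)).
rewrite (nf_Call_unary _ G' _ f _ Henv) by (econstructor; [exact HpX | exact Henv]).
apply repl_e_eeq; [reflexivity|]. rewrite HeX. exact He.
Qed.

Lemma denotable_ifz k G ts e d d' : denotable k G (Lam ts e) -> denotable k G (Lam [] d) ->
  denotable k G (Lam [] d') ->
  denotable k G (repl_p (fun i => match i with
                                  | 0 => ren_e (shift (length G) (length ts)) d
                                  | S _ => ren_e (shift (length G) (length ts)) d'
                                  end) (Lam ts e)).
Proof.
intros He Hd Hd'. apply denotable_Lam in He. destruct He as (M & HM & He).
apply denotable_ground in Hd, Hd'. destruct Hd as (L & HL & Hd), Hd' as (L' & HL' & Hd').
set (As := [Arr ts; N; N]). set (Ms := [M; L; L']).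
assert (HMs : typed_terms k G As Ms) by (repeat constructor; assumption).
destruct (nf_Call_combinator_head k G As ts Ms HMs 0 M eq_refl eq_refl) as [HX HeX].
pose proof (typed_combinator_env k G As ts Ms HMs) as Henv.
set (G' := G ++ As ++ ts) in *. set (X := apps _ _) in *.
set (Xs := [X; TVar (length G + 1); TVar (length G + 2)]).
assert (HXs : typed_terms k G' [N; N; N] Xs).
{ constructor; [exact HX|].
  repeat constructor; apply has_type_Var; unfold G'; rewrite nth_error_app_add; reflexivity. }
assert (Hifz : has_type k G' TIfz (Arr ([N; N; N] ++ []))) by constructor.
apply (denotable_combinator k G As ts Ms HMs (apps TIfz Xs)).
{ exact (has_type_apps HXs _ _ Hifz). }
fold G'. rewrite (nf_Call_apps HXs Henv (Forall2_nil _) _ Hifz), app_nil_r.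
etransitivity;
  [|symmetry; exact (nf_Call_ifz _ G' _ _ _ _ Henv (typed_interp_args HXs Henv))].
assert (Hbranch : forall j L0 d0, nth_error Ms j = Some L0 -> nth_error As j = Some N ->
  has_type k G L0 N -> eeq d0 (nf G (Call (Clo (interp G L0) (id_env G)) [] [])) ->
  eeq (ren_e (shift (length G) (length ts)) d0)
    (nf (G ++ ts) (Call (Clo (interp G' (TVar (length G + j))) (combinator_env G ts Ms)) [] []))).
{ intros j L0 d0 HMj HAj HL0 Hd0. unfold G'.
  rewrite (nf_Call_combinator_param k G As ts Ms HMs j L0 [] [] HMj HAj (Forall2_nil _)).
  rewrite nf_weaken; [apply ren_e_eeq, Hd0|].
  econstructor; [|constructor | constructor].
  econstructor; [exact (typed_interp HL0) | apply typed_id_env]. }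
apply repl_e_eeq; [|rewrite HeX; exact He].
intros [|i]; [apply (Hbranch 1 L) | apply (Hbranch 2 L')]; auto.
Qed.

(* The premises of [gen] occur under a conjunction, out of reach of the derived induction
   principle. *)
Lemma gen_denotable k G p : gen k G p -> denotable k G p.
Proof.
revert G p. fix IH 3. intros G p H.
destruct H as [G x ts qs q Hx Hn Hq Hp | G s q q' Hq Hp | G n q Hp | G q f q' Hq Hp
  | G ts e d e' q' He Hd He' Hp | G ss e qs q' Hl He Hq Hp];
  (eapply denotable_peq; [|exact Hp]).
- apply denotable_var; [exact Hx | exact Hn |].
  intros i Hi. destruct (Hq i Hi) as [Hg Ht]. split; [exact (IH _ _ Hg) | exact Ht].
- exact (denotable_lam k G s q (IH _ _ Hq)).
- exists (TNum n), N. split; [constructor | apply peq_refl].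
- apply denotable_fun. exact (IH _ _ Hq).
- apply denotable_ifz; [exact (IH _ _ He) | exact (IH _ _ Hd) | exact (IH _ _ He')].
- apply denotable_plug; [exact Hl | exact (IH _ _ He) |].
  intros i Hi. destruct (Hq i Hi) as [Hg Ht]. split; [exact (IH _ _ Hg) | exact Ht].
Qed.

Theorem theorem3p8 (k : nat) (hk : 1 <= k) (G : list ty) (p : proc) :
  denotable k G p <-> gen k G p.
Proof.
split; [|apply gen_denotable].
intros (M & t & HM & Hp). exact (gen_peq k G _ p (gen_interp k G M t HM) Hp).
Qed.
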